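(* Let $k$ be a field, let $p<q$ be coprime positive integers, $\mathcal{R}=k[[z^p,z^q]]$, let $r\ge 1$ be an integer (the rank), and let $\widetilde{\Gamma}=r\cdot(\mathbb{Z}_+p+\mathbb{Z}_+q)$. Let $\overrightarrow{\Delta}=\{\Delta_0\subset\Delta_1\subset\dots\subset\Delta_\ell\}$ be a rank-$r$ standard flag of $\widetilde{\Gamma}$-modules of length $\ell$, with $\Delta_i=\Delta_{i-1}\cup\{g_i\}$ for $1\le i\le\ell$ and $g_1<g_2<\dots<g_\ell$. Then the variety $\mathcal{J}^{\ell}_{r}(\overrightarrow{\Delta})$ is biregularly isomorphic to an affine space $\mathbb{A}^N$ over $k$ with $$N=\dim \mathcal{J}_{r}(\Delta_0)+\sum_{i=0}^{\ell-1}\mu_{\Delta_i,g_{i+1}}.$$ Moreover, for every standard rank-$r$ $\widetilde{\Gamma}$-module $\Delta$ and every $g\in\mathbb{N}\setminus\Delta$ such that $\Delta'=\Delta\cup\{g\}$ is also a $\widetilde{\Gamma}$-module (in particular for $\Delta=\Delta_i$, $g=g_{i+1}$), the dimension change $\mu_{\Delta,g}=\dim\mathcal{J}^1_{r}(\{\Delta\subset\Delta\cup\{g\}\})-\dim\mathcal{J}_r(\Delta)$ equals $$\mu_{\Delta,g}=\gamma_{\Delta'}(g)-\gamma_{\Delta'}(g+r p)-\bigl(\gamma_{\Delta'}(g+r q)-\gamma_{\Delta'}(g+r p+r q)\bigr).$$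
   Context: Here $\mathbb{N}=\mathbb{Z}_+=\{0,1,2,\dots\}$. Let $\mathcal{O}=k[[z]]$ and $\widetilde{\mathcal{O}}=\mathcal{O}[z^{1/r}]=k[[z^{1/r}]]$, a free $\mathcal{O}$-module of rank $r$ with basis $z^{i/r}$, $0\le i\le r-1$. The valuation $\upsilon$ on $\widetilde{\mathcal{O}}$ is normalized by $\upsilon(z^{j/r})=j$. For an $\mathcal{R}$-submodule $\mathcal{M}\subset\widetilde{\mathcal{O}}$, $\upsilon(\mathcal{M})=\{\upsilon(y)\mid 0\ne y\in\mathcal{M}\}$. Such an $\mathcal{M}$ is called standard (of rank $r$) if it generates $\widetilde{\mathcal{O}}$ over $\mathcal{O}$; equivalently, $\{0,1,\dots,r-1\}\subset\upsilon(\mathcal{M})$. A standard rank-$r$ $\widetilde{\Gamma}$-module is a subset $\Delta\subset\mathbb{N}$ with $\Delta+\widetilde{\Gamma}\subset\Delta$ and $\{0,1,\dots,r-1\}\subset\Delta$. A rank-$r$ standard flag of length $\ell$ is a chain $\Delta_0\subset\dots\subset\Delta_\ell$ of standard rank-$r$ $\widetilde{\Gamma}$-modules with $\Delta_i=\Delta_{i-1}\cup\{g_i\}$, $g_i\notin\Delta_{i-1}$, and $g_1<g_2<\dots<g_\ell$. The gap counting function is $\gamma_\Delta(b)=|[b,\infty)\setminus\Delta|$, the number of integers $\ge b$ not in $\Delta$. $\mathcal{J}_r(\Delta)$ is the variety of all standard $\mathcal{R}$-modules $\mathcal{M}\subset\widetilde{\mathcal{O}}$ with $\upsilon(\mathcal{M})=\Delta$.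 $\mathcal{J}^{\ell}_r(\overrightarrow{\Delta})$ is the variety of all flags $\mathcal{M}_0\subset\mathcal{M}_1\subset\dots\subset\mathcal{M}_\ell$ of standard $\mathcal{R}$-submodules of $\widetilde{\mathcal{O}}$ with $\upsilon(\mathcal{M}_i)=\Delta_i$ for all $0\le i\le\ell$. Variety structure: let $c$ be the conductor of $\mathcal{R}$, the smallest integer with $z^c\mathcal{O}\subset\mathcal{R}$. Every standard $\mathcal{M}$ contains $z^c\widetilde{\mathcal{O}}$, so standard $\mathcal{M}$ with $\upsilon(\mathcal{M})=\Delta$ are identified with $\mathcal{R}$-invariant $k$-subspaces of $\widetilde{\mathcal{O}}/z^c\widetilde{\mathcal{O}}$ of codimension $|\mathbb{N}\setminus\Delta|$ satisfying the jump conditions prescribed by $\Delta$ (the quotient of the elements of valuation $\ge s$ by those of valuation $\ge s+1$ is one-dimensional for $s\in\Delta$, $s<rc$, and zero for $s\notin\Delta$). Thus $\mathcal{J}_r(\Delta)$ is a locally closed subvariety of a Grassmannian, and $\mathcal{J}^\ell_r(\overrightarrow{\Delta})$ is a locally closed subvariety of a product of Grassmannians. *)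

(* Defs.v *)
From HB Require Import structures.
From mathcomp Require Import all_boot all_order all_algebra finmap.
From mathcomp Require Import all_classical.

Set Implicit Arguments.
Unset Strict Implicit.
Unset Printing Implicit Defensive.

Import Order.TTheory GRing.Theory Num.Theory.
Local Open Scope classical_set_scope.
Local Open Scope ring_scope.

(** * Varieties over [k], through their functors of points

  The base field is arbitrary (possibly finite), so a variety is not determined
  by its [k]-points.  A [kspace] records its [A]-points for every commutative
  [k]-algebra [A] as a subset [pts A] of an ambient set [amb A], together with
  the base change maps.  No functoriality laws are recorded: in the uses below
  the source of an isomorphism is a genuine functor with [pts A] everything, so
  that naturality forces base change to preserve [pts] and to be functorial on
  the target as well. *)
Record kspace (k : fieldType) := KSpace {
  amb : comAlgType k -> Type;
  pts : forall A : comAlgType k, set (amb A);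
  bc : forall A B : comAlgType k, {lrmorphism A -> B} -> amb A -> amb B }.
Arguments pts {k} _ _.
Arguments bc {k} _ {A B} _.

(* By Yoneda, a natural bijection on points is a biregular isomorphism. *)
Definition isomorphic (k : fieldType) (X Y : kspace k) : Prop :=
  exists f : forall A : comAlgType k, amb X A -> amb Y A,
    (forall A, set_bij (pts X A) (pts Y A) (f A)) /\
    (forall (A B : comAlgType k) (phi : {lrmorphism A -> B}) (x : amb X A),
       pts X A x -> f B (bc X phi x) = bc Y phi (f A x)).

Definition affine_space (k : fieldType) (N : nat) : kspace k :=
  @KSpace k (fun A => 'rV[A]_N) (fun A => setT)
    (fun A B phi v => map_mx phi v).

(* [B] is the coordinate ring of [X], with universal point [u]. *)
Definition represents (k : fieldType) (X : kspace k) (B : comAlgType k)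
    (u : amb X B) : Prop :=
  (forall (A : comAlgType k) (h : {lrmorphism B -> A}), pts X A (bc X h u)) /\
  (forall (A : comAlgType k) (x : amb X A), pts X A x ->
     exists2 h : {lrmorphism B -> A}, bc X h u = x &
       forall h' : {lrmorphism B -> A}, bc X h' u = x -> h' =1 h).

(* [idealr_closed] includes properness. *)
Definition prime_chain (B : comNzRingType) (d : nat) : Prop :=
  exists P : nat -> {pred B},
    (forall i, (i <= d)%N -> idealr_closed (P i) /\ prime_idealr_closed (P i)) /\
    (forall i, (i < d)%N -> {subset P i <= P i.+1} /\
       exists2 x, x \in P i.+1 & x \notin P i).

Definition krull_dim (B : comNzRingType) (d : nat) : Prop :=
  prime_chain B d /\ forall e, prime_chain B e -> (e <= d)%N.

(* The varieties considered below are closed in a Schubert cell, hence affine: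
   their dimension is the Krull dimension of the coordinate ring. *)
Definition has_dim (k : fieldType) (X : kspace k) (d : nat) : Prop :=
  exists (B : comAlgType k) (u : amb X B), represents u /\ krull_dim B d.

Definition var_dim (k : fieldType) (X : kspace k) : nat :=
  xget 0%N [set d | has_dim X d].

(** * The rings

  A series is its sequence of coefficients.  Elements of
  [Otilde = A[[z^(1/r)]]] are written in the variable [t = z^(1/r)], so that the
  coefficient of index [j] belongs to the monomial of valuation [j]. *)
Definition series (A : Type) := nat -> A.

Definition ser_mul (A : nzRingType) (f g : series A) : series A :=
  fun n => \sum_(i < n.+1) f i * g (n - i)%N.

(* Series of valuation at least [s]. *)
Definition val_ge (A : nzRingType) (s : nat) : set (series A) :=
  [set f | forall i, (i < s)%N -> f i = 0].
Arguments val_ge : clear implicits.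

(* [A[[z^p, z^q]]], as a set of series in [z]: the image of [A[[x, y]]] under
   [x |-> z^p], [y |-> z^q]. *)
Definition Rz (A : nzRingType) (p q : nat) : set (series A) :=
  [set f | exists a : nat -> nat -> A, forall n,
     f n = \sum_(i < n.+1) \sum_(j < n.+1 | (i * p + j * q == n)%N) a i j].
Arguments Rz : clear implicits.

(* The substitution [z = t^r], from [A[[z]]] to [A[[t]]]. *)
Definition subst_z (A : nzRingType) (r : nat) (f : series A) : series A :=
  fun n => if (r %| n)%N then f (n %/ r)%N else 0.

Definition O_in (A : nzRingType) (r : nat) : set (series A) :=
  range (@subst_z A r).
Arguments O_in : clear implicits.

Definition R_in (A : nzRingType) (p q r : nat) : set (series A) :=
  @subst_z A r @` Rz A p q.
Arguments R_in : clear implicits.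

(* The least [c] such that [z^c O] is contained in [R], over [k]. *)
Definition conductor (k : fieldType) (p q : nat) : nat :=
  xget 0%N [set c | val_ge k c `<=` Rz k p q /\
    forall c', val_ge k c' `<=` Rz k p q -> (c <= c')%N].

Definition submodule (A : nzRingType) (S M : set (series A)) : Prop :=
  [/\ M (fun=> 0),
      (forall f g, M f -> M g -> M (fun n => f n + g n)) &
      (forall a f, S a -> M f -> M (ser_mul a f))].

(* [M] generates [Otilde] over [O]. *)
Definition standard (A : nzRingType) (r : nat) (M : set (series A)) : Prop :=
  forall N : set (series A), submodule (O_in A r) N -> M `<=` N -> N = setT.

(** * Combinatorics of standard modules *)

Definition tGamma (p q r : nat) : set nat :=
  [set n | exists a b : nat, n = (r * (a * p + b * q))%N].

Definition Gamma_module (p q r : nat) (D : set nat) : Prop :=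
  forall n m, D n -> tGamma p q r m -> D (n + m)%N.

Definition standard_Gamma_module (p q r : nat) (D : set nat) : Prop :=
  Gamma_module p q r D /\ forall i, (i < r)%N -> D i.

(* Only [D 0, ..., D l] and [g 1, ..., g l] matter. *)
Definition standard_flag (p q r l : nat) (D : nat -> set nat) (g : nat -> nat) :
    Prop :=
  [/\ (forall i, (i <= l)%N -> standard_Gamma_module p q r (D i)),
      (forall i, (i < l)%N ->
         ~ D i (g i.+1) /\ D i.+1 = D i `|` [set g i.+1]) &
      (forall i j, (0 < i)%N -> (i < j)%N -> (j <= l)%N -> (g i < g j)%N)].

(* The complement of a standard module is finite. *)
Definition gamma (D : set nat) (b : nat) : nat :=
  #|` fset_set ([set n | (b <= n)%N] `\` D) |%fset.

(** * The varieties of standard modules and flags *)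

Definition trunc (A : nzRingType) (n : nat) (f : series A) : 'rV[A]_n :=
  \row_(i < n) f i.

(* [A]-points of the Grassmannian of subspaces of codimension [e] of [k^n]:
   direct summands of [A^n] (images of idempotents) of constant corank [e]. *)
Definition grassmannian (A : comNzRingType) (n e : nat) (W : set 'rV[A]_n) :
    Prop :=
  exists E : 'M[A]_n,
    [/\ E *m E = E, W = [set v | v *m E = v] &
        forall (K : fieldType) (phi : {rmorphism A -> K}),
          (\rank (map_mx phi E) + e = n)%N].

(* Coefficients of [t^s] of the elements of [M] of valuation at least [s]; this
   is the quotient of those elements by the ones of valuation at least [s+1]. *)
Definition lead (A : nzRingType) (M : set (series A)) (s : nat) : set A :=
  [set f s | f in M `&` val_ge A s].

(* Over a general [A], the graded pieces must be free of rank one and direct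
   summands for [s] in [D], and zero otherwise. *)
Definition jumps (A : nzRingType) (D : set nat) (M : set (series A)) : Prop :=
  forall s, (D s -> lead M s = setT) /\ (~ D s -> lead M s = [set 0]).

Definition valuation_set (A : nzRingType) (M : set (series A)) : set nat :=
  [set s | exists f, [/\ M f, val_ge A s f & f s != 0]].

Lemma R_in_const (A : nzRingType) (p q r : nat) (a : A) :
  R_in A p q r (fun n => if n == 0%N then a else 0).
Proof.
exists (fun n => if n == 0%N then a else 0).
  exists (fun i j => if (i == 0%N) && (j == 0%N) then a else 0) => n.
  rewrite big_ord_recl [X in _ + X]big1 => [|i _]; last first.
    by rewrite big1.
  rewrite addr0 big_mkcond big_ord_recl /= big1 => [|j _]; last first.
    by case: ifP.
  by rewrite addr0 /= !mul0n eq_sym.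
apply/funext => n; rewrite /subst_z; case: (n =P 0%N) => [->|n0].
  by rewrite dvdn0 div0n.
case: ifP => // rn; case: eqP => // nr0; case: n0.
by rewrite -(divnK rn) nr0.
Qed.

Lemma ser_mul_const (A : nzRingType) (a : A) (f : series A) :
  ser_mul (fun n => if n == 0%N then a else 0) f = fun n => a * f n.
Proof.
apply/funext => n; rewrite /ser_mul big_ord_recl [X in _ + X]big1 => [|i _].
  by rewrite addr0 subn0.
by rewrite mul0r.
Qed.

(* On points over a field, the jump conditions say that the set of valuations
   of [M] is [D]. *)
Lemma jumps_field (K : fieldType) (p q r : nat) (D : set nat)
    (M : set (series K)) : submodule (R_in K p q r) M ->
  jumps D M <-> valuation_set M = D.
Proof.
case=> M0 _ Mmul; split=> [JM|<- s].
  apply/seteqP; split=> s.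
    case=> f [Mf vf fs]; apply: contrapT => nDs.
    have [_ /(_ nDs) L] := JM s.
    have : lead M s (f s) by exists f.
    by rewrite L /= => /eqP; rewrite (negPf fs).
  move=> Ds; have [/(_ Ds) L _] := JM s.
  have [f [Mf vf] fs] : lead M s 1 by rewrite L.
  by exists f; split=> //; rewrite fs oner_neq0.
split=> [[f [Mf vf fs]]|nDs]; apply/seteqP; split=> // a.
  move=> _; exists (fun n => a / f s * f n); last by rewrite divfK.
  split; last by move=> i /vf ->; rewrite mulr0.
  by rewrite -ser_mul_const; apply: Mmul => //; exact: R_in_const.
  case=> f [Mf vf] <-; apply/eqP; apply: contrapT => /negP fs.
  by apply: nDs; exists f.
by move=> ->; exists (fun=> 0).
Qed.

(* A module [M] containing [z^c Otilde] is a point of a Grassmannian through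
   its image [M / z^c Otilde] in [Otilde / z^c Otilde = A^(r c)]. *)
Definition Jpoint (k : fieldType) (p q r : nat) (D : set nat)
    (A : comAlgType k) (M : set (series A)) : Prop :=
  let n := (r * conductor k p q)%N in
  [/\ submodule (R_in A p q r) M, standard r M, val_ge A n `<=` M,
      grassmannian (gamma D 0) (@trunc A n @` M) & jumps D M].

(* The [B]-span of the image of [M], plus [z^c Otilde_B]. *)
Definition Jbc (k : fieldType) (p q r : nat) (A B : comAlgType k)
    (phi : {lrmorphism A -> B}) (M : set (series A)) : set (series B) :=
  [set f | exists (n : nat) (b : 'I_n -> B) (m : 'I_n -> series A),
     (forall i, M (m i)) /\
     forall j, (j < r * conductor k p q)%N ->
       f j = \sum_(i < n) b i * phi (m i j)].

Definition Jmod (k : fieldType) (p q r : nat) (D : set nat) : kspace k :=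
  @KSpace k (fun A => set (series A)) (fun A => @Jpoint k p q r D A)
    (fun A B phi M => @Jbc k p q r A B phi M).

Definition Jflag (k : fieldType) (p q r l : nat) (D : nat -> set nat) :
    kspace k :=
  @KSpace k (fun A => 'I_l.+1 -> set (series A))
    (fun A => [set M | (forall i : 'I_l.+1, @Jpoint k p q r (D i) A (M i)) /\
                       (forall i j : 'I_l.+1, (i <= j)%N -> M i `<=` M j)])
    (fun A B phi M i => @Jbc k p q r A B phi (M i)).

Definition mu (k : fieldType) (p q r : nat) (D : set nat) (g : nat) : int :=
  (var_dim (Jflag k p q r 1 (fun i => if i == 0%N then D else D `|` [set g])))%:Z
    - (var_dim (Jmod k p q r D))%:Z.

(* Main.v *)
(* Write [P = r p], [Q = r q], so that [z^p = t^P] and [z^q = t^Q].  A flag over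
   [D 0, ..., D l] is determined by one element [F a = t^(gen a) + ...] for each
   residue [a] mod [P], where [gen a] is the generator of [D l] as a [P]-module in
   that class and only exponents outside [D 0] occur in the tail: [M_i] is spanned
   by the [t^(m P) F a] whose exponent [gen a + m P] lies in [D i].  That
   [g_1 < ... < g_l] makes [g_i + P] and [g_i + Q] elements of [D 0], and the only
   condition left is [t^Q F a \in M_0] for all [a].

   The coefficient of this condition at [j + Q], a gap of [D 0], expresses the
   difference between the coefficient of [F a] at [j] and the one of [F b] at the
   same distance from its leading term, with [gen b = gen a + Q] mod [P], through
   coefficients closer to the leading terms.  As [a] runs through a cycle of
   [a |-> a + Q], some [j + Q] has the residue mod [P] of an element of
   [0, ..., r - 1] and hence lies in [D 0], so that the cycle of equations is broken
   and the system can be solved recursively: the coefficients at the [j] with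
   [j + Q] in [D 0] are free coordinates.  They are counted by
   [sum_a (gamma (gen a + 1) - gamma (gen a + Q))], where adding [g] to [D l]
   replaces the generator [g + P] by [g].

   The dimension of the affine space is the Krull dimension of a polynomial ring in
   [N] variables; a chain of [N + 2] primes would produce [N + 1] algebraically
   independent elements, which a count of monomials excludes. *)
Require Import Defs.
From HB Require Import structures.
From mathcomp Require Import all_boot all_order all_algebra finmap.
From mathcomp Require Import all_classical.
From mathcomp Require Import zify mpoly.

Set Implicit Arguments.
Unset Strict Implicit.
Unset Printing Implicit Defensive.

Import Order.TTheory GRing.Theory Num.Theory.
Local Open Scope classical_set_scope.
Local Open Scope ring_scope.

(** * Krull dimension of polynomial rings *)

Section IdealFacts.
Variable (B : comNzRingType).

Lemma idealr_closedMl (P : {pred B}) a u : idealr_closed P -> u \in P -> a * u \in P.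
Proof. by case=> P0 _ PD uP; rewrite -[a * u]addr0 PD. Qed.

Lemma prime_idealX (P : {pred B}) x n : idealr_closed P ->
  prime_idealr_closed P -> x \notin P -> x ^+ n \notin P.
Proof.
move=> [_ P1 _] Pp xP; elim: n => [|n IH]; first by rewrite expr0.
by rewrite exprS; apply/negP => /Pp; rewrite (negPf xP) (negPf IH).
Qed.

End IdealFacts.

Section AlgebraicIndependence.
Variables (k : fieldType) (B : comAlgType k).

(* The monomial in [x 0, ..., x (n - 1)] whose exponents are the [n] base [b]
   digits of [m]. *)
Fixpoint digit_monomial (x : nat -> B) (b n m : nat) : B :=
  if n is n'.+1 then
    x 0%N ^+ (m %% b) * digit_monomial (fun i => x i.+1) b n' (m %/ b)
  else 1.

(** Nesting in the first variable mirrors a chain of primes: each inclusion of the chain eliminates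
    one element of [x]. *)
Fixpoint digit_poly (x : nat -> B) (b n : nat) (c : nat -> k) : B :=
  if n is n'.+1 then
    \sum_(j < b) x 0%N ^+ j *
      digit_poly (fun i => x i.+1) b n' (fun m => c (j + b * m)%N)
  else (c 0%N)%:A.

Lemma digit_poly0 x b n c :
  (forall m, (m < b ^ n)%N -> c m = 0) -> digit_poly x b n c = 0.
Proof.
elim: n x c => [|n IH] x c c0 /=; first by rewrite c0 ?expn0 // scale0r.
apply: big1 => j _; rewrite IH ?mulr0 // => m mb; apply: c0.
have := ltn_ord j; rewrite expnS; nia.
Qed.

Lemma digit_polyE x b n c : digit_poly x b n c =
  \sum_(m < b ^ n) c m *: digit_monomial x b n m.
Proof.
elim: n x c => [|n IH] x c /=.
  by rewrite expn0 big_ord1.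
rewrite expnS; under eq_bigr do rewrite IH mulr_sumr.
case: b IH => [|b] IH; first by rewrite !big_ord0.
rewrite pair_bigA /=; set N := (b.+1 ^ n)%N.
have lt1 (p : 'I_b.+1 * 'I_N) : (p.1 + b.+1 * p.2 < b.+1 * N)%N.
  by case: p => [[i /= ?] [j /= ?]]; nia.
have N0 : (0 < N)%N by rewrite expn_gt0.
have lt2 (m : 'I_(b.+1 * N)) : (m %/ b.+1 < N)%N.
  by rewrite ltn_divLR // [X in (_ < X)%N]mulnC.
rewrite (reindex (fun p => Ordinal (lt1 p))) /=; last first.
  exists (fun m : 'I_(b.+1 * N) => (Ordinal (ltn_pmod m (ltn0Sn b)), Ordinal (lt2 m))).
    move=> [i j] _; congr (_, _); apply: val_inj => /=.
      by rewrite addnC [X in (X + _)%N]mulnC modnMDl modn_small.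
    by rewrite addnC [X in (X + _)%N]mulnC divnMDl // divn_small ?addn0.
  by move=> m _; apply: val_inj => /=; rewrite addnC [X in (X + _)%N]mulnC -divn_eq.
apply: eq_bigr => -[i j] _ /=.
have [-> ->] : ((i + b.+1 * j) %% b.+1 = i /\ (i + b.+1 * j) %/ b.+1 = j)%N.
  by rewrite addnC mulnC modnMDl divnMDl // modn_small // divn_small // addn0.
by rewrite scalerAr.
Qed.

(* Modulo [P 1] the relation becomes one between [x 1, x 2, ...], once it has
   been divided by the largest possible power of [x 0], a nonzero element of
   the domain [B / P 0]. *)
Lemma chain_independent n (P : nat -> {pred B}) (x : nat -> B) b c :
  (forall i, (i <= n)%N -> idealr_closed (P i) /\ prime_idealr_closed (P i)) ->
  (forall i, (i < n)%N ->
     [/\ {subset P i <= P i.+1}, x i \in P i.+1 & x i \notin P i]) ->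
  digit_poly x b n c \in P 0%N -> forall m, (m < b ^ n)%N -> c m = 0.
Proof.
elim: n P x c => [|n IH] P x c Pi Px.
  have [[P0 P1 PD] _] := Pi 0%N isT.
  (* A nonzero constant in [P 0] would be a unit, against properness. *)
  move=> /= cP [|m]; rewrite ?expn0 // => _; apply: contrapT => /eqP c0.
  move: P1; apply/negP/negPn.
  have := idealr_closedMl (c 0%N)^-1%:A (Pi 0%N isT).1 cP.
  by rewrite -scalerAl mul1r scalerA mulVf // scale1r.
move=> cP; set y := fun i => x i.+1.
have [P01 xP1 xP0] := Px 0%N isT.
have [idP0 prP0] := Pi 0%N isT; have [idP1 prP1] := Pi 1%N isT.
have key j : (j < b)%N -> forall m, (m < b ^ n)%N -> c (j + b * m)%N = 0.
  elim/ltn_ind: j => j IHj jb; apply: (IH (fun i => P i.+1) y).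
  - by move=> i; apply: (Pi i.+1).
  - by move=> i; apply: (Px i.+1).
  pose E i := digit_poly y b n (fun m => c (i + b * m)%N).
  have Esum : digit_poly x b n.+1 c =
     x 0%N ^+ j * (E j + x 0%N * \sum_(i < b | (j < i)%N) x 0%N ^+ (i - j.+1) * E i).
    rewrite /= (bigID (fun i : 'I_b => (i < j)%N)) /= big1 ?add0r; last first.
      move=> i ij; rewrite digit_poly0 ?mulr0 // => m; exact: IHj.
    rewrite (bigD1 (Ordinal jb)) ?ltnn //= mulrDr; congr (_ + _).
    rewrite mulrA -exprSr mulr_sumr; apply: eq_big => [i|i].
      by rewrite -leqNgt ltn_neqAle andbC eq_sym.
    move=> /andP[]; rewrite -leqNgt => ji /negP ji'.
    have {ji'} ji : (j < i)%N.
      by rewrite ltn_neqAle ji andbT; apply/negP => /eqP ij; apply/ji'/eqP/val_inj.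
    by rewrite mulrA -exprD subnKC.
  (* No power of [x 0] lies in the prime [P 0], so the second factor does, hence lies in [P 1];
     there [x 0] is zero and only [E j] remains. *)
  move: cP; rewrite Esum => /prP0; rewrite (negPf (prime_idealX _ idP0 prP0 xP0)) /=.
  move/P01; set S := \sum_(i < b | _) _ => ES.
  have [_ _ D1] := idP1.
  by have := D1 (- S) _ _ xP1 ES; rewrite mulNr [S * _]mulrC addrCA addNr addr0.
move=> m; rewrite expnS => mb.
have b0 : (0 < b)%N by case: (b) mb.
rewrite (divn_eq m b) addnC mulnC; apply: key; first exact: ltn_pmod.
by rewrite ltn_divLR // mulnC.
Qed.

End AlgebraicIndependence.

Section MpolyDimension.
Variable (k : fieldType).

(** [msize] is the total degree plus one; bounds of the form [d.+1] make degrees add and cover the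
    zero polynomial. *)
Lemma msize_mulS N (p q : {mpoly k[N]}) d e :
  (msize p <= d.+1)%N -> (msize q <= e.+1)%N -> (msize (p * q) <= (d + e).+1)%N.
Proof.
have [->|p0] := eqVneq p 0; first by rewrite mul0r msize0.
have [->|q0] := eqVneq q 0; first by rewrite mulr0 msize0.
move=> pd qe; rewrite msizeM // -subn1 leq_subLR add1n -addSn -addnS.
exact: leq_add.
Qed.

Lemma msize_digit_monomial N (x : nat -> {mpoly k[N]}) b n d m :
  (0 < b)%N -> (forall i, (i < n)%N -> (msize (x i) <= d.+1)%N) ->
  (msize (digit_monomial x b n m) <= (n * (b * d)).+1)%N.
Proof.
move=> b0; elim: n x m => [|n IH] x m xd /=; first by rewrite msize1.
rewrite mulSn; apply: msize_mulS; last by apply: IH => i; apply: (xd i.+1).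
have Xd e : (msize (x 0%N ^+ e) <= (e * d).+1)%N.
  elim: e => [|e IHe]; first by rewrite expr0 msize1.
  by rewrite exprS mulSn; apply: msize_mulS => //; apply: xd.
by apply: leq_trans (Xd _) _; rewrite ltnS leq_mul2r ltnW ?orbT // ltn_mod.
Qed.

Lemma card_bmultinom_le N d : (#|{: 'X_{1..N < d.+1}}| <= d.+1 ^ N)%N.
Proof.
pose f (m : 'X_{1..N < d.+1}) : {ffun 'I_N -> 'I_d.+1} :=
  [ffun i => inord (bmnm m i)].
have <- : #|{: {ffun 'I_N -> 'I_d.+1}}| = (d.+1 ^ N)%N by rewrite card_ffun !card_ord.
apply: (leq_card f) => m m' /ffunP ff; apply/val_inj/mnmP => i.
have lt (m1 : 'X_{1..N < d.+1}) : (bmnm m1 i < d.+1)%N.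
  have := bmdeg m1; rewrite mdegE (bigD1 i) //=; lia.
by have := ff i; rewrite !ffunE => /(congr1 val); rewrite /= !inordK.
Qed.

Lemma wide_kernel m n (M : 'M[k]_(m, n)) : (n < m)%N ->
  exists2 v : 'rV_m, v != 0 & v *m M = 0.
Proof.
move=> nm; have : kermx M != 0.
  rewrite -mxrank_eq0 mxrank_ker subn_eq0 -ltnNge.
  exact: leq_ltn_trans (rank_leq_col M) nm.
case/rowV0Pn => v; rewrite sub_kermx => /eqP vM v0; by exists v.
Qed.

(* There are more monomials with exponents less than [b] in [N + 1] elements
   than the dimension of the space of polynomials in which they lie. *)
Lemma mpoly_dependent N (x : nat -> {mpoly k[N]}) : exists b (c : nat -> k),
  digit_poly x b N.+1 c = 0 /\ exists2 m, (m < b ^ N.+1)%N & c m != 0.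
Proof.
pose d := (\sum_(i < N.+1) msize (x i))%N.
have xd i : (i < N.+1)%N -> (msize (x i) <= d.+1)%N.
  by move=> iN; rewrite /d (bigD1 (Ordinal iN)) //=; lia.
(* [e] bounds the degrees of the [b ^ N.+1] monomials in [x]. Since [e.+1 <= b * K], they lie in a
   space of dimension at most [b ^ N * K ^ N], and [b] is chosen just above [K ^ N]. *)
pose K := (N.+1 * d).+1; pose b := (K ^ N).+1; pose e := (N.+1 * (b * d))%N.
pose M : 'M[k]_(b ^ N.+1, #|{: 'X_{1..N < e.+1}}|) :=
  \matrix_(i, j) (digit_monomial x b N.+1 i)@_(bmnm (enum_val j : 'X_{1..N < e.+1})).
have lt : (#|{: 'X_{1..N < e.+1}}| < b ^ N.+1)%N.
  apply: leq_ltn_trans (card_bmultinom_le N e) _.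
  apply: (@leq_ltn_trans ((b * K) ^ N)).
    have le : (e.+1 <= b * K)%N by rewrite /e /K mulnS; nia.
    by case: (N) => [|n]; rewrite ?expn0 // leq_exp2r.
  by rewrite expnMn expnSr ltn_pmul2l // expn_gt0.
have [v v0 vM] := wide_kernel M lt.
pose c (m : nat) := if insub m is Some i then v 0 i else 0.
have cE (i : 'I_(b ^ N.+1)) : c i = v 0 i by rewrite /c valK.
exists b, c; split; last first.
  have /rV0Pn[i vi] := v0.
  by exists i => //; rewrite cE.
rewrite digit_polyE; apply/mpolyP => m; rewrite mcoeff0 raddf_sum /=.
have [me|me] := ltnP (mdeg m) e.+1.
  have := congr1 (fun w : 'rV_ _ => w 0 (enum_rank (BMultinom me))) vM.
  rewrite !mxE => vm; rewrite -[RHS]vm; apply: eq_bigr => i _.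
  by rewrite mcoeffZ cE mxE enum_rankK.
apply: big1 => i _; rewrite mcoeffZ memN_msupp_eq0 ?mulr0 //.
apply: contraL me => /msize_mdeg_lt mi; rewrite -ltnNge.
by apply: leq_trans mi _; apply: msize_digit_monomial.
Qed.

(** The chain of length [N] consists of the kernels of setting the first [i] variables to zero. A
    longer chain yields [N.+1] elements that are independent by [chain_independent] and dependent by
    [mpoly_dependent]. *)
Lemma krull_dim_mpoly N : krull_dim {mpoly k[N]} N.
Proof.
split.
  pose t i : N.-tuple {mpoly k[N]} :=
    [tuple if (j < i)%N then 0 else 'X_j | j < N].
  exists (fun i p => p \mPo t i == 0); split=> i iN.
    split; last by move=> u v; rewrite !unfold_in rmorphM mulf_eq0.
    split; rewrite ?unfold_in ?rmorph0 ?rmorph1 ?oner_eq0 //.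
    by move=> a u v; rewrite !unfold_in rmorphD rmorphM /= => /eqP-> /eqP->;
      rewrite mulr0 addr0.
  split.
    move=> p; rewrite !unfold_in => /eqP p0; apply/eqP.
    (* Killing [i.+1] variables factors through killing [i] of them. *)
    have -> : p \mPo t i.+1 = (p \mPo t i) \mPo t i.+1; last by rewrite p0 rmorph0.
    rewrite [LHS]comp_mpolyEX (comp_mpolyEX p (t i)) raddf_sum.
    apply: eq_bigr => m _; rewrite /= !comp_mpolyZ !comp_mpolyX rmorph_prod; congr (_ *: _).
    apply: eq_bigr => j _; rewrite rmorphXn /= !tnth_mktuple; congr (_ ^+ _).
    case: (ltnP j i) => ji; first by rewrite ltnW // rmorph0.
    by rewrite comp_mpolyXU -tnth_nth tnth_mktuple.
  exists 'X_(Ordinal iN); rewrite !unfold_in comp_mpolyXU -tnth_nth tnth_mktuple /=.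
    by rewrite ltnSn.
  by rewrite ltnn -msize_poly_eq0 msizeX.
move=> e [P [Pi Px]]; rewrite leqNgt; apply/negP => Ne.
have /choice[x xP] : forall i, exists x, (i < e)%N -> x \in P i.+1 /\ x \notin P i.
  move=> i; case: (ltnP i e) => [ie|]; last by exists 0.
  by have [_ [x x1 x2]] := Px i ie; exists x.
have [b [c [c0 [m mb]]]] := mpoly_dependent x.
apply/negP/negPn/eqP; apply: (@chain_independent _ _ N.+1 P x b c) mb.
- by move=> i iN; apply: Pi; lia.
- move=> i iN; have ie : (i < e)%N by lia.
  by have [s _] := Px i ie; have [x1 x2] := xP i ie.
- by rewrite c0; have [[]] := Pi 0%N isT.
Qed.

End MpolyDimension.

(** * Universal property of polynomial rings and dimension of affine space *)

Section Representability.
Variables (k : fieldType).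

Section MpolyEval.
Variables (N : nat) (A : comAlgType k) (a : 'rV[A]_N).

Definition mpoly_eval : {mpoly k[N]} -> A := mmap (in_alg A) (a 0).

HB.instance Definition _ := GRing.RMorphism.copy mpoly_eval (mmap (in_alg A) (a 0)).

Fact mpoly_eval_scalable : scalable mpoly_eval.
Proof. by move=> c p; rewrite /mpoly_eval mmapZ /= -scalerAl mul1r. Qed.

HB.instance Definition _ :=
  GRing.isScalable.Build k {mpoly k[N]} A *:%R mpoly_eval mpoly_eval_scalable.

Lemma mpoly_evalX i : mpoly_eval 'X_i = a 0 i.
Proof. by rewrite /mpoly_eval mmapX mmap1U. Qed.

Lemma mpoly_eval_uniq (h : {lrmorphism {mpoly k[N]} -> A}) :
  (forall i, h 'X_i = a 0 i) -> h =1 mpoly_eval.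
Proof.
move=> hX p; rewrite [p]mpolyE !raddf_sum /=; apply: eq_bigr => m _.
rewrite !linearZ /=; congr (_ *: _); rewrite mpolyXE_id !rmorph_prod.
by apply: eq_bigr => i _; rewrite !rmorphXn /= hX mpoly_evalX.
Qed.

End MpolyEval.

Definition mpoly_vars N : 'rV[{mpoly k[N]}]_N := \row_i 'X_i.

Lemma represents_mpoly N (X : kspace k)
    (f : forall A : comAlgType k, 'rV[A]_N -> amb X A) :
  (forall A, set_bij setT (pts X A) (f A)) ->
  (forall (A B : comAlgType k) (phi : {lrmorphism A -> B}) x,
     f B (map_mx phi x) = bc X phi (f A x)) ->
  represents (f _ (mpoly_vars N)).
Proof.
move=> fbij fbc; split=> [A h|A x Xx].
  by rewrite -fbc; have [/(_ _ I)] := fbij A.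
have [_ inj surj] := fbij A.
have [a _ ax] := surj _ Xx.
have mapE (h : {lrmorphism {mpoly k[N]} -> A}) :
    map_mx h (mpoly_vars N) = a <-> forall i, h 'X_i = a 0 i.
  split=> [<- i|hX]; first by rewrite !mxE.
  by apply/rowP => i; rewrite !mxE hX.
exists (mpoly_eval a); first by rewrite -fbc -ax; congr f; apply/mapE/mpoly_evalX.
move=> h'; rewrite -fbc -ax => /inj h'a; apply: mpoly_eval_uniq.
by apply/mapE/h'a; rewrite inE.
Qed.

(** Primes pull back along [h']; inclusions stay strict because [h x] is a preimage of [x]. *)
Lemma prime_chain_can (B B' : comNzRingType) (h : {rmorphism B -> B'})
    (h' : {rmorphism B' -> B}) d :
  cancel h h' -> prime_chain B d -> prime_chain B' d.
Proof.
move=> hK [P [Pi Px]]; exists (fun i x => h' x \in P i); split=> i id.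
  have [[P0 P1 PD] Pp] := Pi i id; split; last first.
    by move=> u v; rewrite !unfold_in rmorphM => /Pp.
  split; rewrite ?unfold_in ?rmorph0 ?rmorph1 // => a u v.
  by rewrite !unfold_in rmorphD rmorphM; apply: PD.
have [sub [x x1 x0]] := Px i id; split; first by move=> y; apply: sub.
by exists (h x); rewrite unfold_in hK.
Qed.

(* [represents] alone does not make [h |-> bc X h u] natural in [h], as [kspace]
   records no functoriality law. *)
Lemma var_dim_affine N (X : kspace k) :
  (forall (A B C : comAlgType k) (phi : {lrmorphism A -> B})
     (psi : {lrmorphism B -> C}) (chi : {lrmorphism A -> C}) x,
     (forall a, chi a = psi (phi a)) -> bc X psi (bc X phi x) = bc X chi x) ->
  isomorphic (affine_space k N) X -> var_dim X = N.
Proof.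
move=> bcM [f [fbij fbc0]].
have fbc (A B : comAlgType k) (phi : {lrmorphism A -> B}) x :
    f B (map_mx phi x) = bc X phi (f A x) by apply: fbc0.
have fR := @represents_mpoly N X f fbij fbc.
have dimN : has_dim X N.
  by exists {mpoly k[N]}, (f _ (mpoly_vars N)); split; last exact: krull_dim_mpoly.
rewrite /var_dim; case: xgetP => [d _|/(_ N)/(_ dimN)] //.
(* [var_dim] may have selected a dimension computed from any representing algebra [B], so [B] has to
   be compared with the polynomial ring. *)
move=> [B [u [[bc_u ex_u] [dB maxB]]]].
have [_ ex_vars] := fR.
have inj_f A x y : f A x = f A y -> x = y.
  by have [_ inj _] := fbij A; apply: inj; rewrite inE.
have pts_f A x : pts X A (f A x) by have [/(_ _ I)] := fbij A.
(* These are the coordinates of [bc X idfun u], which [represents] asserts to be a point, unlike [u]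
   itself. *)
have [_ _ /(_ _ (bc_u B idfun))[b _ bE]] := fbij B.
have bc_uE (A : comAlgType k) (h : {lrmorphism B -> A}) :
    bc X h u = f A (map_mx h b).
  by rewrite fbc bE (bcM _ _ _ _ _ h).
have [h hU _] := ex_u _ _ (pts_f _ (mpoly_vars N)).
have [h' h'U _] := ex_vars _ _ (pts_f _ b).
have {hU} hb : map_mx h b = mpoly_vars N by apply: inj_f; rewrite -bc_uE.
have {h'U} h'v : map_mx h' (mpoly_vars N) = b by apply: inj_f; rewrite fbc.
(* Both composites fix the universal coordinates, so each is the identity by uniqueness. *)
have hK : cancel h h'.
  have [g _ g_uniq] := ex_u _ _ (pts_f _ b).
  have gI : idfun =1 g.
    by apply: g_uniq; rewrite bc_uE; congr f; apply/rowP => i; rewrite mxE.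
  have gM : h' \o h =1 g.
    apply: g_uniq; rewrite bc_uE -[in RHS]h'v -hb; congr f.
    by apply/rowP => i; rewrite !mxE.
  by move=> y; have := gM y; rewrite -gI.
have h'K : cancel h' h.
  have uniq (g : {lrmorphism {mpoly k[N]} -> {mpoly k[N]}}) :
      map_mx g (mpoly_vars N) = mpoly_vars N -> g =1 mpoly_eval (mpoly_vars N).
    by move=> gv; apply: mpoly_eval_uniq => i; rewrite -gv !mxE.
  have eM : h \o h' =1 mpoly_eval (mpoly_vars N).
    by apply: uniq; rewrite -[RHS]hb -h'v; apply/rowP => i; rewrite !mxE.
  have eI : idfun =1 mpoly_eval (mpoly_vars N).
    by apply: uniq; apply/rowP => i; rewrite mxE.
  by move=> y; have := eM y; rewrite -eI.
have [dN maxN] := krull_dim_mpoly k N.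
apply/eqP; rewrite eqn_leq maxN ?maxB //; last exact: prime_chain_can hK dB.
exact: prime_chain_can h'K dN.
Qed.

End Representability.

(** * Triangular families of power series *)

Section WellFoundedFixpoint.
Variables (X A : Type) (meas : X -> nat) (G : (X -> A) -> X -> A) (c0 : X -> A).
Hypothesis G_local : forall c c' x,
  (forall y, (meas y < meas x)%N -> c y = c' y) -> G c x = G c' x.

(** [G c x] reads [c] only at smaller measure, so [(meas x).+1] iterations settle the value at [x],
    whatever the start [c0]. *)
Definition wf_fix (x : X) : A := iter (meas x).+1 G c0 x.

Lemma wf_fixE x : wf_fix x = G wf_fix x.
Proof.
have stable m n y : (meas y < m)%N -> (meas y < n)%N ->
    iter m G c0 y = iter n G c0 y.
  elim: m n y => [|m IH] [|n] y //=; rewrite !ltnS => ym yn.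
  by apply: G_local => z zy; apply: IH; exact: leq_trans zy _.
rewrite /wf_fix [LHS]/=; apply: G_local => y yx.
by apply: stable => //; rewrite ltnS.
Qed.

Lemma wf_fix_uniq c c' :
  (forall x, c x = G c x) -> (forall x, c' x = G c' x) -> c =1 c'.
Proof.
move=> cE c'E x; have [n] := ubnP (meas x); elim: n x => // n IH x xn.
rewrite cE c'E; apply: G_local => y yx; apply: IH.
by rewrite (leq_trans yx) // -ltnS.
Qed.

End WellFoundedFixpoint.

Section Series.
Variable A : nzRingType.
Implicit Types (f g : series A) (W M : set (series A)) (a b : A).

(** Multiplication by [t^s]. *)
Definition shift s f : series A := fun n => if (n < s)%N then 0 else f (n - s)%N.

Lemma shift0 f : shift 0 f = f.
Proof. by apply/funext => n; rewrite /shift ltn0 subn0. Qed.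

Lemma shiftD s u f : shift s (shift u f) = shift (s + u) f.
Proof.
apply/funext => n; rewrite /shift.
case: (ltnP n s) => ns; first by case: ltnP => //; lia.
by rewrite ltn_subLR // subnDA.
Qed.

Lemma shift_addn s f n : shift s f (n + s)%N = f n.
Proof. by rewrite /shift ltnNge leq_addl addnK. Qed.

Lemma val_ge_shift s m f : val_ge A m f -> val_ge A (m + s) (shift s f).
Proof. by move=> fm n ns; rewrite /shift; case: ltnP => // sn; apply: fm; lia. Qed.

Lemma val_geW m n f : (n <= m)%N -> val_ge A m f -> val_ge A n f.
Proof. by move=> nm fm i iin; apply: fm; apply: leq_trans nm. Qed.

Definition linear_set W : Prop :=
  [/\ W (fun=> 0), (forall f g, W f -> W g -> W (fun n => f n + g n)) &
      (forall a f, W f -> W (fun n => a * f n))].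

Lemma linear_set_sub W f g : linear_set W -> W f -> W g -> W (fun n => f n - g n).
Proof.
case=> _ WD WZ Wf Wg; have := WD _ _ Wf (WZ (-1) _ Wg).
by congr W; apply/funext => n; rewrite mulN1r.
Qed.

Lemma linear_set_sum W (I : Type) (s : seq I) (P : pred I) (F : I -> series A) :
  linear_set W -> (forall i, P i -> W (F i)) -> W (fun n => \sum_(i <- s | P i) F i n).
Proof.
move=> [W0 WD _] WF; elim: s => [|i s IH].
  by move: W0; congr W; apply/funext => n; rewrite big_nil.
have [Pi|Pi] := boolP (P i).
  by have := WD _ _ (WF i Pi) IH; congr W; apply/funext => n; rewrite big_cons Pi.
by move: IH; congr W; apply/funext => n; rewrite big_cons (negPf Pi).
Qed.

(** Membership depends only on the coefficients below [n], which lets finite sums replace infinite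
    expansions. *)
Lemma linear_set_cut W n f g : linear_set W -> val_ge A n `<=` W ->
  (forall i, (i < n)%N -> f i = g i) -> W f -> W g.
Proof.
move=> [W0 WD WZ] Wn fg Wf.
have -> : g = fun i => f i + (g i - f i) by apply/funext => i; rewrite addrC subrK.
by apply: WD => //; apply: Wn => i iin; rewrite fg ?subrr.
Qed.

Lemma linear_set_val_ge n : linear_set (val_ge A n).
Proof.
split=> // [f g fn gn i iin|a f fn i iin]; first by rewrite fn ?gn ?addr0.
by rewrite fn // mulr0.
Qed.

Lemma linear_setI W W' : linear_set W -> linear_set W' -> linear_set (W `&` W').
Proof.
move=> [W0 WD WZ] [W0' WD' WZ']; split=> //.
  by move=> f g [? ?] [? ?]; split; [apply: WD|apply: WD'].
by move=> a f [? ?]; split; [apply: WZ|apply: WZ'].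
Qed.

Lemma linear_set_shift W s : linear_set W -> linear_set [set f | W (shift s f)].
Proof.
move=> [W0 WD WZ]; split=> /=.
- by move: W0; congr W; apply/funext => n; rewrite /shift if_same.
- move=> f g Wf Wg; have := WD _ _ Wf Wg; congr W; apply/funext => n; rewrite /shift.
  by case: ifP; rewrite ?addr0.
- move=> a f Wf; have := WZ a _ Wf; congr W; apply/funext => n; rewrite /shift.
  by case: ifP; rewrite ?mulr0.
Qed.

(** * Expansion of series in a triangular family *)

Section Reduction.
Variables (S : set nat) (h : nat -> series A).

Definition red_step f (c : series A) : series A :=
  fun n => f n - \sum_(s < n | (s : nat) \in S) c s * h s n.

(* The coefficients of the expansion of [f] in the family of the [h s] for [s]
   in [S] and of the monomials of exponents outside [S]. *)
Definition red f : series A := wf_fix id (red_step f) (fun=> 0).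

Lemma red_step_local f c c' n :
  (forall m, (m < n)%N -> c m = c' m) -> red_step f c n = red_step f c' n.
Proof. by move=> cc; rewrite /red_step; congr (_ - _); apply: eq_bigr => s _; rewrite cc. Qed.

Lemma redE f n : red f n = f n - \sum_(s < n | (s : nat) \in S) red f s * h s n.
Proof. exact: (wf_fixE _ (@red_step_local f)). Qed.

Lemma red_uniq f c : (forall n, c n = red_step f c n) -> red f = c.
Proof.
move=> cE; apply/funext; apply: (wf_fix_uniq (@red_step_local f)) => // n.
exact: redE.
Qed.

Lemma redD f g : red (fun n => f n + g n) = fun n => red f n + red g n.
Proof.
apply: red_uniq => n; rewrite /red_step [red f n]redE [red g n]redE.
under [in RHS]eq_bigr do rewrite mulrDl.
by rewrite big_split opprD addrACA.
Qed.

Lemma redZ a f : red (fun n => a * f n) = fun n => a * red f n.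
Proof.
apply: red_uniq => n; rewrite /red_step [red f n]redE mulrBr mulr_sumr.
by under [in RHS]eq_bigr do rewrite -mulrA.
Qed.

Lemma red0 : red (fun=> 0) = fun=> 0.
Proof.
by apply: red_uniq => n; rewrite /red_step big1 ?subr0 // => i _; rewrite mul0r.
Qed.

Lemma red_local f g n : (forall m, (m <= n)%N -> f m = g m) -> red f n = red g n.
Proof.
elim/ltn_ind: n => n IH fg; rewrite !redE fg //; congr (_ - _).
apply: eq_bigr => s _; congr (_ * _); apply: IH => // m ms.
by apply: fg; apply: leq_trans ms _; apply: ltnW.
Qed.

Lemma val_ge_red m f : val_ge A m f -> val_ge A m (red f).
Proof.
move=> fm n nm; rewrite (@red_local _ (fun=> 0)) ?red0 // => i iin.
by apply: fm; apply: leq_ltn_trans nm.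
Qed.

Lemma red_lead m f : val_ge A m f -> red f m = f m.
Proof.
move=> fm; rewrite redE big1 ?subr0 // => s _.
by rewrite (val_ge_red fm) ?mul0r.
Qed.

(** The closed span of the [h s], given by linear equations instead of infinite sums. *)
Definition span : set (series A) := [set f | forall j, ~ S j -> red f j = 0].

Lemma linear_span : linear_set span.
Proof.
split=> [j _|f g fS gS j jS|a f fS j jS]; first by rewrite red0.
  by rewrite redD fS ?gS ?addr0.
by rewrite redZ fS ?mulr0.
Qed.

Lemma val_ge_span n : (forall j, (n <= j)%N -> S j) -> val_ge A n `<=` span.
Proof.
move=> nS f fn j jS; apply: (val_ge_red fn); rewrite ltnNge.
by apply/negP => /nS.
Qed.

Definition triangular : Prop :=
  forall s, S s -> h s s = 1 /\ val_ge A s (h s).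

Hypothesis h_tri : triangular.

Lemma red_h s : S s -> red (h s) = fun n => (n == s)%:R.
Proof.
move=> Ss; have [hs hsv] := h_tri Ss; apply: red_uniq => n; rewrite /red_step.
case: (ltngtP n s) => [ns|sn|->].
- by rewrite hsv // big1 ?subr0 // => i _; rewrite (ltn_eqF (ltn_trans _ ns)) ?mul0r.
- rewrite (bigD1 (Ordinal sn)) ?mem_set //= eqxx mul1r big1 ?addr0 ?subrr // => i.
  case/andP=> _; rewrite -val_eqE /= => /negPf->; exact: mul0r.
- by rewrite hs big1 ?subr0 // => i _; rewrite ltn_eqF ?mul0r.
Qed.

Lemma span_h s : S s -> span (h s).
Proof. by move=> Ss j jS; rewrite red_h //; case: eqP => // js; case: jS; rewrite js. Qed.

(** The recursion for [red] stops before [n]. By triangularity, the term [s = n] contributes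
    [red f n] and the later ones vanish at [n]. *)
Lemma red_expand m f n : (n < m)%N ->
  f n = (if n \in S then 0 else red f n) + \sum_(s < m | (s : nat) \in S) red f s * h s n.
Proof.
move=> nm; rewrite -[f n in LHS](subrK (\sum_(s < n | (s : nat) \in S) red f s * h s n)) -redE.
rewrite -!(big_mkord (fun s => s \in S) (fun s => red f s * h s n)).
rewrite [in RHS](@big_cat_nat _ _ _ n) //=; last exact: ltnW.
rewrite [X in _ + (_ + X)]big_ltn_cond //.
have -> : \sum_(n.+1 <= s < m | s \in S) red f s * h s n = 0.
  apply: big1_seq => s /andP[sS]; rewrite mem_index_iota => /andP[ns _].
  by have [_ ->] := h_tri (set_mem sS); rewrite ?mulr0.
case: ifP => nS; last by rewrite addr0.
by have [-> _] := h_tri (set_mem nS); rewrite mulr1 addr0 add0r addrC.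
Qed.

Lemma span_expand m f n : span f -> (n < m)%N ->
  f n = \sum_(s < m | (s : nat) \in S) red f s * h s n.
Proof.
move=> fS nm; rewrite {1}(red_expand f nm); case: ifPn; rewrite ?add0r // notin_setE => nS.
by rewrite fS ?add0r.
Qed.

Lemma span_min W n : linear_set W -> val_ge A n `<=` W ->
  (forall s, S s -> (s < n)%N -> W (h s)) -> span `<=` W.
Proof.
move=> linW Wn Wh f fS.
apply: (@linear_set_cut _ n (fun i => \sum_(s < n | (s : nat) \in S) red f s * h s i)) => //.
  by move=> i iin; rewrite -span_expand.
apply: linear_set_sum => // s /set_mem sS; case: linW => _ _ WZ.
by apply: WZ; apply: Wh.
Qed.

Lemma jumps_span : jumps S span.
Proof.
move=> s; split=> sS; apply/seteqP; split=> //.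
  move=> a _; exists (fun n => a * h s n); last by rewrite (h_tri sS).1 mulr1.
  split; first by case: linear_span => _ _; apply; apply: span_h.
  by move=> i iis; rewrite (h_tri sS).2 ?mulr0.
  by move=> a [f [fS fs] <-] /=; rewrite -(red_lead fs) fS.
by move=> a ->; exists (fun=> 0) => //; split=> //; case: linear_span.
Qed.

End Reduction.

(** For [f] in the smaller span, the coordinates relative to [S] vanish off [S], so they also solve
    the recursion for [S']. *)
Lemma span_mono S S' h : S `<=` S' -> span S h `<=` span S' h.
Proof.
move=> SS' f fS; suff -> : span S' h f = (forall j, ~ S' j -> red S h f j = 0).
  by move=> j jS; apply: fS => /SS'.
suff red_eq : red S' h f = red S h f by rewrite /span /= red_eq.
apply: red_uniq => n; rewrite redE /red_step; congr (_ - _).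
rewrite big_mkcond [RHS]big_mkcond /=; apply: eq_bigr => s _.
case: ifPn => [/set_mem/SS' sS|]; first by rewrite mem_set.
by rewrite notin_setE => sS; rewrite fS // mul0r if_same.
Qed.

(** The first nonzero coefficient would sit at a gap, where leading coefficients of [M] are zero. *)
Lemma jumps_eq0 S M f : jumps S M -> M f -> (forall j, S j -> f j = 0) ->
  f = fun=> 0.
Proof.
move=> JM Mf f0; apply/funext => n; elim/ltn_ind: n => n IH.
have [nS|nS] := pselect (S n); first exact: f0.
have [_ /(_ nS) L] := JM n.
by have : lead M n (f n); [exists f|rewrite L].
Qed.

(** Elimination from left to right: at each exponent of [S], subtract an element of [M] with the
    required leading coefficient. *)
Lemma jumps_reduce S M n f m : linear_set M -> val_ge A n `<=` M -> jumps S M ->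
  exists2 g, (M `&` val_ge A m) g & forall j, (m <= j)%N -> S j -> f j = g j.
Proof.
move=> linM Mn JM; have [d] := ubnP (n - m); elim: d m f => // d IH m f dm.
have [nm|mn] := leqP n m.
  (* From exponent [n] on, [M] contains every series, so the tail of [f] itself serves. *)
  exists (fun j => if (j < m)%N then 0 else f j).
    by split; [apply: Mn|] => j jm; rewrite ?(leq_trans jm nm) ?jm.
  by move=> j; rewrite leqNgt => /negPf->.
have [h [Mh hm] hE] : exists2 h, (M `&` val_ge A m) h & S m -> f m = h m.
  have [mS|mS] := pselect (S m); last by exists (fun=> 0) => //; split=> //; case: linM.
  have [/(_ mS) L _] := JM m.
  have [h Mh hE] : lead M m (f m) by rewrite L.
  by exists h.
have [|g [Mg gm] gE] := IH m.+1 (fun j => f j - h j); first by lia.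
have gm' := val_geW (leqnSn m) gm.
exists (fun j => h j + g j).
  by have [_ LD _] := linear_setI linM (linear_set_val_ge m); apply: LD.
move=> j; rewrite leq_eqVlt => /predU1P[<- mS|mj jS].
  by rewrite gm ?addr0 ?hE.
by rewrite -gE // addrC subrK.
Qed.

Lemma jumps_span_eq S h M n : triangular S h ->
  linear_set M -> val_ge A n `<=` M -> jumps S M ->
  (forall s, S s -> M (h s)) -> M = span S h.
Proof.
move=> tri linM Mn JM Mh.
have sub : span S h `<=` M by apply: (span_min tri linM Mn) => s + _; apply: Mh.
apply/seteqP; split=> // f Mf.
(* The monomial of exponent [j >= n] lies in [M] with leading coefficient 1, so [j] is not a gap. *)
have span_n : val_ge A n `<=` span S h.
  apply: val_ge_span => j nj; apply: contrapT => jS.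
  have [_ /(_ jS) L] := JM j.
  have : lead M j 1 by exists (fun i => (i == j)%:R); [split|];
    rewrite ?eqxx //; first apply: Mn; move=> i ij /=; rewrite ltn_eqF //;
    exact: leq_trans ij _.
  by rewrite L => /eqP; rewrite oner_eq0.
have [g [gS _] gE] :=
  @jumps_reduce _ _ _ f 0 (linear_span S h) span_n (jumps_span tri).
suff /funext fg : forall i, f i = g i by rewrite (_ : f = g) //; apply/funext.
move=> i; apply/eqP; rewrite -subr_eq0; apply/eqP.
have := jumps_eq0 JM (linear_set_sub linM Mf (sub _ gS)).
by move=> /(_ _)/(congr1 (@^~ i)); apply=> j jS; rewrite gE ?subrr.
Qed.

End Series.

(** * Standard modules over the semigroup *)

Section Conductor.
Variables (k : fieldType) (p q r : nat).
Hypotheses (p_gt0 : (0 < p)%N) (q_gt0 : (0 < q)%N) (pq_coprime : coprime p q).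

Lemma coprime_represent n : (p * q <= n)%N ->
  exists i j, n = (i * p + j * q)%N.
Proof.
case: (egcdnP q p_gt0) => u v; rewrite (eqP pq_coprime) => uE _ le_n.
have [i iq iE] : exists2 i, (i < q)%N & i * p = n %[mod q].
  exists ((u * n) %% q)%N; first by rewrite ltn_mod.
  by rewrite modnMml mulnAC uE mulnDl mul1n mulnAC modnMDl.
have ipn : (i * p <= n)%N by rewrite (leq_trans _ le_n) // mulnC leq_mul2l ltnW ?orbT.
have /dvdnP[j jE] : (q %| n - i * p)%N by rewrite -eqn_mod_dvd // iE.
by exists i, j; rewrite -jE subnKC.
Qed.

(** Each exponent from [c] on receives one chosen representation [w], and its coefficient is placed
    there only. *)
Lemma Rz_represent c : (forall n, (c <= n)%N -> exists i j, n = (i * p + j * q)%N) ->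
  val_ge k c `<=` Rz k p q.
Proof.
move=> rep f fc; have /choice[w wP] : forall n, exists w : nat * nat,
    (c <= n)%N -> n = (w.1 * p + w.2 * q)%N.
  move=> n; have [/rep[i [j ijE]]|_] := leqP c n; first by exists (i, j).
  by exists (0, 0)%N.
exists (fun i j => if w (i * p + j * q)%N == (i, j) then f (i * p + j * q)%N else 0) => n.
have [nc|cn] := ltnP n c.
  rewrite fc // big1 // => i _; rewrite big1 // => j /eqP->.
  by rewrite fc ?if_same.
have nE := wP n cn.
have in1 : ((w n).1 < n.+1)%N by move: nE p_gt0 q_gt0; case: (w n) => /= a b; nia.
have in2 : ((w n).2 < n.+1)%N by move: nE p_gt0 q_gt0; case: (w n) => /= a b; nia.
rewrite (bigD1 (Ordinal in1)) //= (bigD1 (Ordinal in2)) -?nE //=.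
rewrite -surjective_pairing eqxx !big1 ?addr0 // => i.
  move=> iw; apply: big1 => j /eqP->; case: eqP => // wE.
  by case/eqP: iw; apply: val_inj; rewrite /= wE.
case/andP=> /eqP-> iw; case: eqP => // wE.
by case/eqP: iw; apply: val_inj; rewrite /= wE.
Qed.

Lemma conductor_represent n : (conductor k p q <= n)%N ->
  exists i j, n = (i * p + j * q)%N.
Proof.
(* The set defining the conductor is nonempty, so [xget] does not return its default. *)
have ex : exists c, `[< val_ge k c `<=` Rz k p q >].
  by exists (p * q)%N; apply/asboolP/Rz_represent/coprime_represent.
have [c0 /asboolP c0R c0min] := ex_minnP ex.
rewrite /conductor; case: xgetP => [c _ [cR _] cn|/(_ c0)]; last first.
  by case; split=> // c' c'R; apply/c0min/asboolP.
have [|a aE] := cR (fun i => (i == n)%:R).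
  by move=> i ic; rewrite ltn_eqF // (leq_trans ic).
apply: contrapT => nrep; have := aE n; rewrite eqxx big1 => [/eqP|i _].
  by rewrite oner_eq0.
by apply: big1 => j /eqP ijn; case: nrep; exists i, j.
Qed.

Definition codim := (r * conductor k p q)%N.

Lemma standard_large (D : set nat) : (0 < r)%N -> standard_Gamma_module p q r D ->
  forall j, (codim <= j)%N -> D j.
Proof.
move=> r_gt0 [DG Dr] j le_j; rewrite (divn_eq j r) addnC mulnC.
apply: DG; first by apply: Dr; rewrite ltn_mod.
have [|a [b ->]] := @conductor_represent (j %/ r); last by exists a, b.
by rewrite leq_divRL // mulnC.
Qed.

End Conductor.

Lemma fset_set_seq (T : choiceType) (s : seq T) :
  fset_set [set` s] = [fset x in s]%fset.
Proof.
apply/fsetP => x; rewrite in_fset_set; last by (apply/finite_seqP; exists s).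
by rewrite in_fset; apply/idP/idP => [/set_mem|?] //; apply/mem_set.
Qed.

Lemma gammaE n (D : set nat) b : (forall j, (n <= j)%N -> D j) ->
  gamma D b = \sum_(j < n | (b <= j)%N && ((j : nat) \notin D)) 1.
Proof.
move=> Dn; rewrite /gamma.
pose s := [seq j <- iota 0 n | (b <= j)%N && (j \notin D)].
have -> : [set j | (b <= j)%N] `\` D = [set` s].
  apply/seteqP; split=> j; rewrite /= mem_filter mem_iota add0n /=.
    move=> [bj jD]; rewrite bj memNset //= ltnNge.
    by apply/negP => /Dn.
  by move=> /andP[/andP[bj]]; rewrite notin_setE.
rewrite fset_set_seq card_fseq undup_id ?filter_uniq ?iota_uniq // size_filter -sum1_count.
by rewrite -[X in iota 0 X]subn0 -/(index_iota 0 n) big_mkord.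
Qed.

(** * Submodules over the semigroup ring *)

Section Submodules.
Variables (A : nzRingType) (p q r : nat).
Hypotheses (p_gt0 : (0 < p)%N) (q_gt0 : (0 < q)%N) (r_gt0 : (0 < r)%N).
Implicit Types (f g : series A) (W M N : set (series A)).

Definition monomial m : series A := fun n => (n == m)%:R.

Lemma ser_mul_monomial m f : ser_mul (monomial m) f = shift m f.
Proof.
apply/funext => n; rewrite /ser_mul /shift /monomial; case: ltnP => mn.
  by rewrite big1 // => i _; rewrite (ltn_eqF (leq_trans _ mn)) ?mul0r.
rewrite (bigD1 (Ordinal (mn : (m < n.+1)%N))) //= eqxx mul1r big1 ?addr0 // => i.
by rewrite -val_eqE /= => /negPf->; rewrite mul0r.
Qed.

Lemma subst_monomial m : subst_z r (monomial m) = monomial (r * m).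
Proof.
apply/funext => n; rewrite /subst_z /monomial; case: ifPn => [/dvdnP[i ->]|rn].
  by rewrite mulnK // mulnC eqn_pmul2l.
by case: eqP rn => // ->; rewrite dvdn_mulr.
Qed.

Lemma O_in_monomial m : O_in A r (monomial (r * m)).
Proof. by exists (monomial m) => //; exact: subst_monomial. Qed.

Lemma O_in_const a : O_in A r (fun n => if n == 0%N then a else 0).
Proof.
exists (fun n => if n == 0%N then a else 0) => //; apply/funext => n.
rewrite /subst_z; case: ifPn => [/dvdnP[m ->]|].
  by rewrite mulnK // muln_eq0 (gtn_eqF r_gt0) orbF.
by case: eqP => // ->; rewrite dvdn0.
Qed.

Lemma R_in_monomial i j : R_in A p q r (monomial (r * (i * p + j * q))).
Proof.
exists (monomial (i * p + j * q)); last exact: subst_monomial.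
exists (fun i' j' => ((i' == i) && (j' == j))%:R) => n; rewrite /monomial.
case: eqP => [->|nij]; last first.
  rewrite big1 // => i' _; rewrite big1 // => j' /eqP ij'.
  by case: eqP => // i'E; case: eqP => // j'E; case: nij; rewrite -ij' i'E j'E.
have ii : (i < (i * p + j * q).+1)%N by nia.
have jj : (j < (i * p + j * q).+1)%N by nia.
rewrite (bigD1 (Ordinal ii)) //= (bigD1 (Ordinal jj)) //= !eqxx !big1 ?addr0 //.
  move=> i'; rewrite -val_eqE /= => /negPf i'i.
  by apply: big1 => j' _; rewrite i'i.
by move=> j' /andP[_]; rewrite -val_eqE /= => /negPf->.
Qed.

Lemma submodule_linear M : submodule (R_in A p q r) M -> linear_set M.
Proof.
case=> M0 MD MM; split=> // a f Mf; rewrite -ser_mul_const.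
by apply: MM => //; exact: R_in_const.
Qed.

Lemma submodule_shift M f i j : submodule (R_in A p q r) M -> M f ->
  M (shift (r * (i * p + j * q)) f).
Proof.
case=> _ _ MM Mf; rewrite -ser_mul_monomial; apply: MM => //.
exact: R_in_monomial.
Qed.

(** As [p], [q], [r] are positive, exponents [r (i p + j q)] below [n] have [i, j < n]; up to order
    [n], multiplication by [a] is a finite combination of shifts. *)
Lemma R_in_mul_coef n a f : R_in A p q r a -> exists b : nat -> nat -> A,
  forall m, (m < n)%N -> ser_mul a f m =
    \sum_(i < n) \sum_(j < n) b i j * shift (r * (i * p + j * q)) f m.
Proof.
case=> c [b cE] <-; exists b => m mn.
pose b' (i j : nat) u := if r * (i * p + j * q) == u then b i j else 0.
have aE u : (u < n)%N -> subst_z r c u = \sum_(i < n) \sum_(j < n) b' i j u.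
  move=> un; rewrite /subst_z /b'; case: ifPn => [/dvdnP[v uE]|ru]; last first.
    rewrite big1 // => i _; rewrite big1 // => j _; case: eqP ru => // <-.
    by rewrite dvdn_mulr.
  have vn : (v < n)%N by apply: leq_ltn_trans un; rewrite uE leq_pmulr.
  rewrite uE mulnK // cE
    (big_ord_widen n (fun i => \sum_(j < v.+1 | (i * p + j * q == v)%N) b i j)) //.
  rewrite big_mkcond; apply: eq_bigr => i _.
  rewrite (big_ord_widen_cond n (fun j => i * p + j * q == v)%N (fun j => b i j)) //.
  case: ifPn => [iv|]; rewrite big_mkcond //=.
    rewrite big_mkcond; apply: eq_bigr => j _.
    rewrite [(v * r)%N]mulnC eqn_pmul2l //; case: eqP => [ijv|_] //=.
    by rewrite ifT //; move: ijv q_gt0; nia.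
  rewrite -leqNgt => vi; rewrite big1 // => j _.
  by case: eqP => // /eqP; rewrite [(v * r)%N]mulnC eqn_pmul2l // => /eqP; nia.
rewrite /ser_mul.
under eq_bigr => u _ do rewrite aE ?(leq_trans (ltn_ord u)) // mulr_suml.
rewrite exchange_big; apply: eq_bigr => i _ /=.
under eq_bigr do rewrite mulr_suml.
rewrite exchange_big; apply: eq_bigr => j _ /=; rewrite /b' /shift.
case: ltnP => [lt_m|le_m].
  rewrite mulr0 big1 // => u _; case: eqP; rewrite ?mul0r // => uE.
  by have := ltn_ord u; lia.
rewrite (bigD1 (Ordinal (le_m : (_ < m.+1)%N))) //= eqxx big1 ?addr0 // => u.
by rewrite -val_eqE /= eq_sym => /negPf->; rewrite mul0r.
Qed.

Lemma submoduleP n M : linear_set M -> val_ge A n `<=` M ->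
  (forall f, M f -> M (shift (r * p) f)) -> (forall f, M f -> M (shift (r * q) f)) ->
  submodule (R_in A p q r) M.
Proof.
move=> linM Mn Mp Mq.
have Mpq i j f : M f -> M (shift (r * (i * p + j * q)) f).
  move=> Mf; elim: i => [|i IH].
    rewrite mul0n add0n; elim: j => [|j IH]; first by rewrite mul0n muln0 shift0.
    by rewrite mulSn mulnDr -shiftD; apply: Mq.
  by rewrite mulSn -addnA mulnDr -shiftD; apply: Mp.
case: (linM) => M0 MD MZ; split=> // a f Ra Mf.
have [b bE] := R_in_mul_coef n f Ra.
apply: (@linear_set_cut _ _ n (fun m => \sum_(i < n) \sum_(j < n)
          b i j * shift (r * (i * p + j * q)) f m)) => //.
  by move=> i iin; rewrite bE.
by apply: linear_set_sum => // i _; apply: linear_set_sum => // j _; apply/MZ/Mpq.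
Qed.

(** Downward induction on the valuation [s]: [D] contains [s %% r], so a power of [z] times an
    element of [M] matches the leading term of [f], and the remainder has larger valuation. *)
Lemma jumps_standard n D M : (forall i, (i < r)%N -> D i) -> val_ge A n `<=` M ->
  jumps D M -> standard r M.
Proof.
move=> Dr Mn JM N [N0 ND NM] MN.
have N_sub f g : N f -> N g -> N (fun i => f i - g i).
  move=> Nf Ng; have := ND _ _ Nf (NM _ _ (O_in_const (-1)) Ng).
  congr N; apply/funext => i; rewrite ser_mul_const mulN1r //.
have all m : (m <= n)%N -> val_ge A (n - m) `<=` N.
  elim: m => [_|m IH mn f fm]; first by rewrite subn0 => f /Mn/MN.
  set s := (n - m.+1)%N in fm.
  have [/(_ (Dr _ (ltn_pmod s r_gt0))) L _] := JM (s %% r)%N.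
  have [g [Mg gs] gE] : lead M (s %% r) (f s) by rewrite L.
  have sE : (s = s %% r + r * (s %/ r))%N by rewrite addnC mulnC -divn_eq.
  have Ng : N (shift (r * (s %/ r)) g).
    by rewrite -ser_mul_monomial; apply: NM; [apply: O_in_monomial|apply: MN].
  have := ND _ _ Ng (IH (ltnW mn) (fun i => f i - shift (r * (s %/ r)) g i) _).
  have -> : (fun i => shift (r * (s %/ r)) g i + (f i - shift (r * (s %/ r)) g i)) = f.
    by apply/funext => i; rewrite addrC subrK.
  apply=> i; have -> : (n - m = s.+1)%N by rewrite /s; lia.
  rewrite ltnS leq_eqVlt => /predU1P[->|iis].
    by rewrite [X in shift _ _ X]sE shift_addn gE subrr.
  by rewrite fm // (val_ge_shift (s := r * (s %/ r)) gs) ?subrr // -sE.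
apply/seteqP; split=> // f _; apply: (all n) => // i; by rewrite subnn.
Qed.

End Submodules.

Lemma rmorph_red (A B : nzRingType) (phi : {rmorphism A -> B}) S (h : nat -> series A) f :
  red S (fun s => phi \o h s) (phi \o f) = phi \o red S h f.
Proof.
apply: red_uniq => n; rewrite /red_step /= [red S h f n]redE rmorphB rmorph_sum.
by congr (_ - _); apply: eq_bigr => s _; rewrite rmorphM.
Qed.

(** * Spans as points of the Grassmannian *)

Section Grassmannian.
Variables (n : nat) (S : set nat).
Hypothesis S_large : forall j, (n <= j)%N -> S j.

Section Projection.
Variables (A : nzRingType) (h : nat -> series A).
Implicit Types (v : 'rV[A]_n) (f : series A).

Definition extend v : series A := fun i => if insub i is Some j then v 0 j else 0.

Lemma extendE v (i : 'I_n) : extend v i = v 0 i.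
Proof. by rewrite /extend valK. Qed.

Lemma extendK : cancel extend (@trunc A n).
Proof. by move=> v; apply/rowP => i; rewrite mxE extendE. Qed.

Lemma extend_large v i : (n <= i)%N -> extend v i = 0.
Proof. by move=> ni; rewrite /extend insubF // ltnNge ni. Qed.

(** Projection onto the gap monomials along [span S h]. *)
Definition rem f : series A := fun j => if j \in S then 0 else red S h f j.

Definition rem_mx : 'M[A]_n := \matrix_(i, j) rem (monomial A i) j.

Lemma red_off (c : series A) : (forall j, S j -> c j = 0) -> red S h c = c.
Proof.
move=> c0; apply: red_uniq => m; rewrite /red_step big1 ?subr0 // => s /set_mem sS.
by rewrite c0 ?mul0r.
Qed.

Lemma rem_off j : ~ S j -> rem (monomial A j) = monomial A j.
Proof.
move=> jS; have e i : S i -> monomial A j i = 0.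
  by rewrite /monomial; case: eqP => // ->.
apply/funext => i; rewrite /rem red_off //; case: ifPn => // /set_mem iS.
by rewrite e.
Qed.

Lemma extend_sum v : extend v = fun i => \sum_(j < n) v 0 j * monomial A j i.
Proof.
apply/funext => i; rewrite /monomial; have [iin|ni] := ltnP i n.
  rewrite -[i]/(val (Ordinal iin)) extendE (bigD1 (Ordinal iin)) //= eqxx mulr1.
  rewrite big1 ?addr0 // => j; rewrite -val_eqE eq_sym => /negPf /= ->.
  exact: mulr0.
by rewrite extend_large // big1 // => j _; rewrite gtn_eqF ?mulr0 // (leq_trans _ ni).
Qed.

Lemma red_sum (I : Type) (s : seq I) (a : I -> A) (F : I -> series A) j :
  red S h (fun m => \sum_(i <- s) a i * F i m) j = \sum_(i <- s) a i * red S h (F i) j.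
Proof.
elim: s => [|i s IH].
  rewrite big_nil; under [X in red _ _ X]eq_fun => ? do rewrite big_nil.
  by rewrite red0.
rewrite big_cons -IH; under [X in red _ _ X]eq_fun => ? do rewrite big_cons.
by rewrite redD redZ.
Qed.

Lemma mul_rem_mx v : v *m rem_mx = trunc n (rem (extend v)).
Proof.
apply/rowP => j; rewrite !mxE extend_sum /rem red_sum.
under eq_bigr do rewrite mxE /rem; case: ifP => // _.
by rewrite big1 // => i _; rewrite mulr0.
Qed.

Lemma span_extend v : span S h (extend v) <-> v *m rem_mx = 0.
Proof.
rewrite mul_rem_mx; split=> [fS|/rowP r0 j jS].
  apply/rowP => j; rewrite !mxE /rem; case: ifPn => //; rewrite notin_setE.
  exact: fS.
have jn : (j < n)%N by rewrite ltnNge; apply/negP => /S_large.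
by have := r0 (Ordinal jn); rewrite !mxE /rem memNset.
Qed.

Lemma rem_mx_idem : rem_mx *m rem_mx = rem_mx.
Proof.
apply/row_matrixP => i; rewrite row_mul mul_rem_mx; apply/rowP => j; rewrite !mxE.
rewrite /rem red_off ?extendE; first by rewrite !mxE /rem; case: ifP => // ->.
move=> m mS; have [mn|nm] := ltnP m n; last by rewrite extend_large.
by rewrite -[m]/(val (Ordinal mn)) extendE !mxE /rem mem_set.
Qed.

Lemma trunc_span : @trunc A n @` span S h = [set v | v *m (1%:M - rem_mx) = v].
Proof.
apply/seteqP; split=> v /=.
  case=> f fS <-; suff /span_extend e : span S h (extend (trunc n f)).
    by rewrite mulmxBr mulmx1 e subr0.
  apply: (linear_set_cut (linear_span S h) (val_ge_span _ S_large) _ fS).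
  by move=> i iin; rewrite -[i in RHS]/(val (Ordinal iin)) extendE mxE.
move=> vE; exists (extend v); last exact: extendK.
apply/span_extend; apply/eqP; rewrite -oppr_eq0 -(addKr v (- _)).
by rewrite -{2}[v]mulmx1 -mulmxBr vE addNr.
Qed.

End Projection.

Lemma rank_rem_mx (K : fieldType) (A : nzRingType)
    (phi : {rmorphism A -> K}) (h : nat -> series A) :
  \rank (map_mx phi (rem_mx h)) = gamma S 0.
Proof.
rewrite (gammaE _ S_large) sum1_card.
set G := [pred i : 'I_n | (i : nat) \notin S].
rewrite -[RHS]/(#|G|).
set E := map_mx phi _.
(* The rows of [T] are the gap monomials. [T *m E = T] since [rem] fixes them, and [E] factors
   through [T] since its columns in [S] vanish; this bounds the rank on both sides. *)
pose T : 'M[K]_(#|G|, n) := \matrix_(i, j) (enum_val i == j)%:R.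
have TTt : T *m T^T = 1%:M.
  apply/matrixP => i j; rewrite !mxE (bigD1 (enum_val i)) //= !mxE eqxx mul1r.
  rewrite big1 ?addr0 => [|m /negPf mi]; last by rewrite !mxE eq_sym mi mul0r.
  by rewrite (inj_eq enum_val_inj) eq_sym.
have rT : \rank T = #|G|.
  by apply/eqP; rewrite -/(row_free T); apply/row_freeP; exists T^T.
have TE : T *m E = T.
  apply/matrixP => i j; rewrite !mxE (bigD1 (enum_val i)) //= !mxE eqxx mul1r.
  rewrite big1 ?addr0 => [|m /negPf mi]; last by rewrite !mxE eq_sym mi mul0r.
  have := enum_valP i; rewrite inE notin_setE => iS.
  by rewrite rem_off // /monomial rmorph_nat eq_sym.
have ET : E = (E *m T^T) *m T.
  apply/matrixP => i j; rewrite -mulmxA [RHS]mxE.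
  have Tj m : (T^T *m T) m j = ((m == j) && (j \in G))%:R.
    rewrite mxE; case: (boolP (m \in G)) => [mG|mG].
      rewrite (bigD1 (enum_rank_in mG m)) //= !mxE enum_rankK_in // eqxx mul1r.
      rewrite big1 ?addr0 => [|l lm].
        by case: eqP => // <-; rewrite mG.
      rewrite !mxE; case: eqP => [lE|]; last by rewrite mul0r.
      by case/eqP: lm; apply: enum_val_inj; rewrite enum_rankK_in.
    rewrite big1; first by case: eqP => // <-; rewrite (negPf mG).
    move=> l _; rewrite !mxE; case: eqP => [lE|]; last by rewrite mul0r.
    by move: mG; rewrite -lE enum_valP.
  rewrite (bigD1 j) //= Tj eqxx big1 ?addr0 => [|m /negPf mj]; last by rewrite Tj mj mulr0.
  rewrite !mxE /rem inE; case: (_ \in S) => /=; last by rewrite mulr1.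
  by rewrite rmorph0 mul0r.
apply/eqP; rewrite eqn_leq; apply/andP; split.
  by have := mxrankM_maxr (E *m T^T) T; rewrite -ET rT.
by have := mxrankM_maxr T E; rewrite TE rT.
Qed.

Lemma grassmannian_span (A : comNzRingType) (h : nat -> series A) :
  grassmannian (gamma S 0) (@trunc A n @` span S h).
Proof.
exists (1%:M - rem_mx h); split; last first.
- move=> K phi; rewrite -(rank_rem_mx phi h) map_mxB map_mx1; set E := map_mx _ _.
  have EE : E *m E = E by rewrite -map_mxM rem_mx_idem.
  apply/eqP; rewrite eqn_leq; apply/andP; split.
    by apply: mulmx0_rank_max; rewrite mulmxBl EE mul1mx subrr.
  by rewrite -[X in (X <= _)%N](mxrank1 K n) -{1}(subrK E 1%:M) mxrank_add.
- exact: trunc_span.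
- by rewrite mulmxBl mul1mx mulmxBr mulmx1 rem_mx_idem subrr subr0.
Qed.

End Grassmannian.

(** * Frames: coordinates on the space of flags *)

(* The generators of [D] as a module over [P N], indexed by residues mod [P]. *)
Definition gen (P : nat) (D : set nat) (a : nat) : nat :=
  xget 0%N [set e | [/\ D e, e = a %[mod P] &
                        forall e', D e' -> e' = a %[mod P] -> (e <= e')%N]].

Section Generators.
Variables (P n : nat) (D : set nat).
Hypotheses (P_gt0 : (0 < P)%N) (D_large : forall j, (n <= j)%N -> D j).

Lemma genP a : [/\ D (gen P D a), gen P D a = a %[mod P] &
  forall e, D e -> e = a %[mod P] -> (gen P D a <= e)%N].
Proof.
rewrite /gen; case: xgetP => // none.
have ex : exists e, `[< D e /\ e = a %[mod P] >].
  exists (n * P + a)%N; apply/asboolP; split; last by rewrite modnMDl.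
  by apply: D_large; nia.
have [e /asboolP[De ea] emin] := ex_minnP ex.
by case: (none e); split=> // e' De' e'a; apply/emin/asboolP.
Qed.

Lemma gen_uniq a e : D e -> e = a %[mod P] ->
  (forall e', D e' -> e' = a %[mod P] -> (e <= e')%N) -> gen P D a = e.
Proof.
move=> De ea emin; have [Dg ga gmin] := genP a.
by apply/eqP; rewrite eqn_leq gmin ?emin.
Qed.

Lemma gen_eqmod a b : a = b %[mod P] -> gen P D a = gen P D b.
Proof.
move=> ab; apply: gen_uniq; have [Dg gb gmin] := genP b; rewrite ?ab //.
Qed.

Lemma gen_le s : D s -> (gen P D s <= s)%N.
Proof. by move=> Ds; have [_ _ /(_ s Ds erefl)] := genP s. Qed.

Lemma gen_dvd s : D s -> exists m, s = (gen P D s + m * P)%N.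
Proof.
move=> Ds; have [_ ge _] := genP s; have le := gen_le Ds.
have /dvdnP[m mE] : (P %| s - gen P D s)%N by rewrite -eqn_mod_dvd // ge.
by exists m; rewrite -mE subnKC.
Qed.

End Generators.

Section Frames.
Variables (p q r l n : nat) (D : nat -> set nat).
Hypotheses (p_gt0 : (0 < p)%N) (q_gt0 : (0 < q)%N) (r_gt0 : (0 < r)%N).
Hypothesis pq_coprime : coprime p q.
Local Notation P := (r * p)%N.
Local Notation Q := (r * q)%N.
Local Notation gen := (gen (r * p) (D l)).
Hypothesis D_std : forall i, (i <= l)%N -> standard_Gamma_module p q r (D i).
Hypothesis D_mono : forall i j, (i <= j)%N -> (j <= l)%N -> D i `<=` D j.
(* For a flag, this expresses that [g_1 < ... < g_l]. *)
Hypothesis D_incr : forall i v, (i <= l)%N -> D i v -> exists2 i', (i' <= i)%N &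
  D i' v /\ forall u, (v < u)%N -> D i' u -> D 0%N u.
Hypothesis D0_large : forall j, (n <= j)%N -> D 0%N j.

Fact P_gt0 : (0 < P)%N. Proof. by rewrite muln_gt0 r_gt0. Qed.

Definition residue (s : nat) : 'I_P := Ordinal (ltn_pmod s P_gt0).

Lemma D_large i : (i <= l)%N -> forall j, (n <= j)%N -> D i j.
Proof. by move=> il j /D0_large; apply: D_mono. Qed.

Let genP := genP P_gt0 (D_large (leqnn l)).
Let gen_eqmod := gen_eqmod P_gt0 (D_large (leqnn l)).
Let gen_le := gen_le P_gt0 (D_large (leqnn l)).
Let gen_dvd := gen_dvd P_gt0 (D_large (leqnn l)).

Lemma gen_residue s : gen (residue s) = gen s.
Proof. by apply: gen_eqmod; rewrite modn_mod. Qed.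

Lemma residue_gen (a : 'I_P) : residue (gen a) = a.
Proof.
by apply: val_inj => /=; have [_ -> _] := genP a; rewrite modn_small.
Qed.

Lemma D_addP i s : (i <= l)%N -> D i s -> D i (s + P)%N.
Proof.
move=> il Ds; have [DG _] := D_std il; apply: DG => //.
by exists 1%N, 0%N; rewrite mul1n mul0n addn0.
Qed.

Lemma D_addQ i s : (i <= l)%N -> D i s -> D i (s + Q)%N.
Proof.
move=> il Ds; have [DG _] := D_std il; apply: DG => //.
by exists 0%N, 1%N; rewrite mul1n mul0n add0n.
Qed.

(** [gen a + Q] stays in the [D i] given by [D_incr], which agrees with [D 0] above [gen a]. *)
Lemma D0_genQ a : D 0%N (gen a + Q)%N.
Proof.
have [Dg _ _] := genP a.
have [i il [Di Di0]] := D_incr (leqnn l) Dg.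
by apply: Di0; [rewrite -[X in (X < _)%N]addn0 ltn_add2l muln_gt0 r_gt0|apply: D_addQ].
Qed.

(** * Flags of modules and frames over a fixed ring *)

Section OneRing.
Variable A : nzRingType.
Implicit Types (F : 'I_P -> series A) (x : 'I_P -> nat -> A).

(** For [s] in [D l] the shift is a multiple of [P], and this is the product of a generator by a
    power of [z^p] with leading exponent [s]. *)
Definition translate F (s : nat) : series A := shift (s - gen s) (F (residue s)).

Definition frame F : Prop := forall a, [/\ F a (gen a) = 1, val_ge A (gen a) (F a) &
  forall j, (gen a < j)%N -> D 0%N j -> F a j = 0].

Definition flag_frame F : Prop :=
  frame F /\ forall a, span (D 0%N) (translate F) (shift Q (F a)).

Lemma translate_gen F (a : 'I_P) : translate F (gen a) = F a.
Proof.
by rewrite /translate (gen_eqmod (b := a)) ?subnn ?shift0 ?residue_gen //; case: (genP a).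
Qed.

Lemma translate_addP F s : D l s -> translate F (s + P) = shift P (translate F s).
Proof.
move=> Ds; rewrite /translate shiftD.
have -> : residue (s + P) = residue s by apply: val_inj; rewrite /= modnDr.
by rewrite (gen_eqmod (b := s)) ?modnDr // addnC addnBA // gen_le.
Qed.

Lemma translate_triangular F i : (i <= l)%N -> frame F -> triangular (D i) (translate F).
Proof.
move=> il Ff s Ds; have le := gen_le (D_mono il (leqnn l) Ds).
have [F1 Fv _] := Ff (residue s); rewrite gen_residue in F1 Fv.
split; last by have := val_ge_shift (s := s - gen s) Fv; rewrite subnKC.
by rewrite /translate -[X in shift _ _ X](subnKC le) shift_addn.
Qed.

Lemma span_shiftP F i f : (i <= l)%N -> frame F ->
  span (D i) (translate F) f -> span (D i) (translate F) (shift P f).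
Proof.
move=> il Ff; have tri := translate_triangular il Ff.
have vn := val_ge_span (translate F) (D_large il).
apply: (span_min (n := n) tri (linear_set_shift P (linear_span _ _))).
  by move=> g gn; apply: vn; apply: val_geW (val_ge_shift gn); exact: leq_addr.
move=> s Ds _ /=; rewrite -translate_addP; last exact: D_mono Ds.
by apply: span_h => //; apply: D_addP.
Qed.

(** On a translate, the factor [t^Q] can be applied to the generator first: the result is in the
    span over [D 0], which is stable under [t^P]. *)
Lemma span_shiftQ F i f : (i <= l)%N -> flag_frame F ->
  span (D i) (translate F) f -> span (D i) (translate F) (shift Q f).
Proof.
move=> il [Ff FQ]; have tri := translate_triangular il Ff.
have vn := val_ge_span (translate F) (D_large il).
apply: (span_min (n := n) tri (linear_set_shift Q (linear_span _ _))).
  by move=> g gn; apply: vn; apply: val_geW (val_ge_shift gn); exact: leq_addr.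
move=> s Ds _ /=; apply: (span_mono (D_mono (leq0n i) il)).
have [m sE] := gen_dvd (D_mono il (leqnn l) Ds).
rewrite /translate shiftD addnC -shiftD.
have -> : (s - gen s = m * P)%N by rewrite {1}sE addKn.
elim: m {sE} => [|m IH]; first by rewrite mul0n shift0.
by rewrite mulSn -shiftD; apply: span_shiftP.
Qed.

Lemma flag_frame_submodule F i : (i <= l)%N -> flag_frame F ->
  submodule (R_in A p q r) (span (D i) (translate F)).
Proof.
move=> il FF; apply: (@submoduleP _ _ _ _ _ _ _ n) => //.
- exact: linear_span.
- exact/val_ge_span/D_large.
- by move=> f; apply: span_shiftP; case: FF.
- by move=> f; apply: span_shiftQ.
Qed.

(** With [i] given by [D_incr], [F a - F' a] lies in the span over [D i] and vanishes on [D i]: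
    leading terms cancel, and beyond them [D i] is in [D 0], where frames have no coefficients. *)
Lemma flag_frame_inj F F' : flag_frame F -> flag_frame F' ->
  (forall i, (i <= l)%N -> span (D i) (translate F) = span (D i) (translate F')) ->
  F = F'.
Proof.
move=> [Ff _] [Ff' _] FF'; apply/funext => a.
have [Dg _ _] := genP a; have [i il [Di Di0]] := D_incr (leqnn l) Dg.
have tri := translate_triangular il Ff.
have tri' := translate_triangular il Ff'.
have Fa := span_h tri Di; have Fa' := span_h tri' Di.
rewrite -FF' // translate_gen in Fa'; rewrite translate_gen in Fa.
have [F1 Fv F0] := Ff a; have [F1' Fv' F0'] := Ff' a.
have FaE : (fun m => F a m - F' a m) = fun=> 0.
  apply: (jumps_eq0 (jumps_span tri)) => [|j Dj];
    first exact: linear_set_sub (linear_span _ _) Fa Fa'.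
  have [jg|gj|->] := ltngtP j (gen a); last by rewrite F1 F1' subrr.
    by rewrite Fv ?Fv' ?subrr.
  by have D0j := Di0 _ gj Dj; rewrite F0 ?F0' ?subrr.
apply/funext => j; apply/eqP; rewrite -subr_eq0; apply/eqP.
by have := congr1 (fun f : series A => f j) FaE.
Qed.

Lemma flag_frame_exists (M : nat -> set (series A)) :
  (forall i, (i <= l)%N -> [/\ submodule (R_in A p q r) (M i), val_ge A n `<=` M i &
                               jumps (D i) (M i)]) ->
  (forall i j, (i <= j)%N -> (j <= l)%N -> M i `<=` M j) ->
  exists2 F, flag_frame F & forall i, (i <= l)%N -> M i = span (D i) (translate F).
Proof.
move=> MP M_mono.
have linM i (il : (i <= l)%N) : linear_set (M i).
  by have [/submodule_linear] := MP i il.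
have M_shift i f u v : (i <= l)%N -> M i f -> M i (shift (r * (u * p + v * q)) f).
  by move=> /MP[sM _ _]; exact: submodule_shift.
have M_shiftP i f m : (i <= l)%N -> M i f -> M i (shift (m * P) f).
  by move=> il /(M_shift _ _ m 0%N il); rewrite mul0n addn0 mulnCA.
have M_shiftQ i f : (i <= l)%N -> M i f -> M i (shift Q f).
  by move=> il /(M_shift _ _ 0%N 1%N il); rewrite mul1n.
have [_ M0n JM0] := MP 0%N (leq0n l).
(* If [D i] has no exponent outside [D 0] from [b] on, elements of [M i] of valuation at least [b]
   are already in [M 0]. *)
have M_tail i b f : (i <= l)%N -> (forall u, (b <= u)%N -> D i u -> D 0%N u) ->
    M i f -> val_ge A b f -> M 0%N f.
  move=> il tail Mf fb.
  have [g [Mg gb] gE] := jumps_reduce f b (linM _ (leq0n l)) M0n JM0.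
  suff fgE : (fun j => f j - g j) = fun=> 0.
    suff -> : f = g by [].
    apply/funext => j; apply/eqP; rewrite -subr_eq0; apply/eqP.
    by have := congr1 (fun f' : series A => f' j) fgE.
  have [_ _ JMi] := MP i il; apply: (jumps_eq0 JMi) => [|j Dj].
    by apply: linear_set_sub (linM i il) Mf (M_mono _ _ (leq0n i) il _ Mg).
  have [jb|bj] := ltnP j b; first by rewrite fb ?gb ?subrr.
  by rewrite gE ?subrr //; apply: tail.
have /choice[F FP] : forall a : 'I_P, exists f : series A,
    [/\ f (gen a) = 1, val_ge A (gen a) f,
        (forall j, (gen a < j)%N -> D 0%N j -> f j = 0),
        (forall i, (i <= l)%N -> D i (gen a) -> M i f) &
        M 0%N (shift P f) /\ M 0%N (shift Q f)].
  move=> a; have [Dg _ _] := genP a.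
  have ex : exists i, `[< (i <= l)%N /\ D i (gen a) >] by exists l; apply/asboolP.
  (* The least [i] puts the generator in every module whose exponents include [gen a], and forces
     the index from [D_incr] to be [i]. *)
  have [i /asboolP[il Di] imin] := ex_minnP ex.
  have [i' i'i [Di' tail]] := D_incr il Di.
  have iE : i' = i.
    by apply/eqP; rewrite eqn_leq i'i imin //; apply/asboolP; rewrite (leq_trans i'i).
  rewrite {i' i'i Di'}iE in tail.
  have [_ _ JM] := MP i il; have [/(_ Di) L _] := JM (gen a).
  have [g [Mg gv] g1] : lead (M i) (gen a) 1 by rewrite L.
  have [g' [Mg' gv'] gE] := jumps_reduce g (gen a).+1 (linM _ (leq0n l)) M0n JM0.
  have Mf : M i (fun j => g j - g' j).
    by apply: linear_set_sub (linM i il) Mg (M_mono _ _ (leq0n i) il _ Mg').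
  have fv : val_ge A (gen a) (fun j => g j - g' j).
    by move=> j jg; rewrite gv ?gv' ?subrr // ltnW // ltnS.
  have M0_shift s : (0 < s)%N -> M i (shift s (fun j => g j - g' j)) ->
      M 0%N (shift s (fun j => g j - g' j)).
    move=> s0 Ms; apply: (M_tail i (gen a + s)%N) => //; last exact: val_ge_shift.
    by move=> u gu; apply: tail; apply: leq_trans gu; rewrite -addn1 leq_add2l.
  exists (fun j => g j - g' j); split=> //.
  - by rewrite g1 gv' // subr0.
  - by move=> j gj Dj; rewrite gE ?subrr.
  - move=> i' i'l Di'; apply: M_mono Mf => //; apply: imin; exact/asboolP.
  - split; apply: M0_shift; rewrite ?muln_gt0 ?r_gt0 //; last exact: M_shiftQ.
    by rewrite -[P]mul1n; apply: M_shiftP.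
have Ff : frame F by move=> a; have [] := FP a.
have ME i : (i <= l)%N -> M i = span (D i) (translate F).
  move=> il; have [_ Mn JM] := MP i il.
  apply: (jumps_span_eq (translate_triangular il Ff) (linM i il) Mn JM) => s Ds.
  have [m sE] := gen_dvd (D_mono il (leqnn l) Ds).
  rewrite /translate {1}sE addKn; have [_ _ _ + []] := FP (residue s).
  rewrite gen_residue => FD FPs _; have [Dg|nDg] := pselect (D i (gen s)).
    by apply: M_shiftP => //; apply: FD.
  (* When [gen s] is not in [D i], [s] lies at least [P] above it, and [t^P] times the generator is
     already in [M 0]. *)
  case: m sE => [|m] sE; first by case: nDg; rewrite sE addn0 in Ds.
  rewrite mulSnr -shiftD; apply: M_shiftP => //.
  exact: (M_mono _ _ (leq0n i) il _ FPs).
exists F => //; split=> // a; rewrite -ME //.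
by have [_ _ _ _ []] := FP a.
Qed.

(** * Recursive solution of the equations *)

Definition free (a : 'I_P) (j : nat) : bool :=
  [&& (gen a < j)%N, j \notin D 0%N & (j + Q)%N \in D 0%N].

(** Forces the shape of a frame, so that the recursion is local on arbitrary coefficient
    families. *)
Definition normalize F (a : 'I_P) : series A := fun j =>
  if (j < gen a)%N then 0 else if j == gen a then 1 else
  if j \in D 0%N then 0 else F a j.

Lemma frame_normalize F : frame (normalize F).
Proof.
move=> a; rewrite /normalize; split=> [|j jg|j gj Dj].
- by rewrite ltnn eqxx.
- by rewrite jg.
- by rewrite ltnNge (ltnW gj) gtn_eqF // mem_set.
Qed.

Lemma normalize_frame F : frame F -> normalize F = F.
Proof.
move=> Ff; apply/funext => a; apply/funext => j; have [F1 Fv F0] := Ff a.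
rewrite /normalize; case: ltngtP => [jg|gj|-> //]; first by rewrite Fv.
by case: ifPn => // /set_mem Dj; rewrite F0.
Qed.

(* The equation [shift Q (F a) \in span (D 0) (translate F)] at [j + Q] gives
   [F a j] as this function of coefficients of [F] of smaller weight. *)
Definition solve_rhs F (a : 'I_P) (j : nat) : A :=
  \sum_(s < (j + Q)%N | (s : nat) \in D 0%N)
    red (D 0%N) (translate F) (shift Q (F a)) s * translate F s (j + Q)%N.

Definition solve_step x (c : 'I_P * nat -> A) (t : 'I_P * nat) : A :=
  normalize (fun a j => if (j + Q)%N \in D 0%N then x a j else
    solve_rhs (normalize (fun b i => c (b, i))) a j) t.1 t.2.

(* That function is [F b i] plus terms closer to the leading ones, where
   [i = j + Q] mod [P] and [i - gen b = j - gen a].  The multiplier is [-1 / q]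
   mod [p], so that [descent i = descent j - 1] mod [p]; and [descent j = 0] would put
   [j] in [D 0]. *)
Definition descent (j : nat) : nat := ((j %/ r) * ((egcdn q p).1 * p.-1) %% p)%N.

(** Lexicographic order: distance to the leading term first, then [descent], which is less than
    [p]. *)
Definition weight (t : 'I_P * nat) : nat := ((t.2 - gen t.1) * p + descent t.2)%N.

Definition solve x : 'I_P -> series A :=
  fun a j => wf_fix weight (solve_step x) (fun=> 0) (a, j).

Lemma descent_lt i j m : ~ D 0%N j -> (i + m * P = j + Q)%N ->
  (descent i < descent j)%N.
Proof.
move=> nDj ij; have [D0G D0r] := D_std (leq0n l).
have p_j : ~~ (p %| j %/ r)%N.
  apply/negP => /dvdnP[b bE]; apply: nDj; rewrite (divn_eq j r) addnC bE.
  apply: D0G; first by apply: D0r; rewrite ltn_mod.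
  by exists b, 0%N; rewrite mul0n addn0 mulnC.
have ij_r : (i %/ r + m * p = j %/ r + q)%N.
  have e u v : ((u + v * r) %/ r = u %/ r + v)%N by rewrite addnC divnMDl // addnC.
  by rewrite -!e; congr (_ %/ _)%N; move: ij; lia.
rewrite /descent; set w := (_ * p.-1)%N.
(* [w] is [-1 / q] mod [p]: the Bezout coefficient inverts [q], and [p.-1] stands for [-1]. *)
have [t tE] : exists t, (w * q + 1 = t * p)%N.
  rewrite /w; case: (egcdnP p q_gt0) => u v /= uE _.
  rewrite gcdnC (eqP pq_coprime) in uE.
  by exists (v * p.-1 + 1)%N; rewrite -{2 3}(prednK p_gt0) in uE *; nia.
have ijw : (i %/ r * w + 1 = j %/ r * w %[mod p])%N.
  rewrite -(modnMDl (m * w) (_ + 1)) -(modnMDl t (j %/ r * w)) -tE.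
  by congr (_ %% _)%N; nia.
(* If the residue for [i] were [p - 1], the one for [j] would wrap around to 0, and [p] would divide
   [j %/ r]. *)
have di := ltn_pmod (i %/ r * w) p_gt0.
rewrite -ijw -modnDml; move: di; rewrite leq_eqVlt => /predU1P[dE|lt_d]; last first.
  by rewrite [X in (_ < X)%N]modn_small addn1.
have pw : (p %| j %/ r * w)%N by rewrite /dvdn -ijw -modnDml addn1 dE modnn.
case/negP: p_j; rewrite -(dvdn_addr _ (dvdn_mulr q pw)).
by rewrite -mulnA -{2}[(j %/ r)%N]muln1 -mulnDr tE mulnA dvdn_mull.
Qed.

Lemma translateE F s j : translate F s j =
  if (j < s - gen s)%N then 0 else F (residue s) (j - (s - gen s))%N.
Proof. by []. Qed.

Section SolveLocal.
Variables (F F' : 'I_P -> series A) (a : 'I_P) (j : nat).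
Hypotheses (Ff : frame F) (Ff' : frame F') (gj : (gen a < j)%N) (nDj : ~ D 0%N j).
Hypothesis FF' : forall b i, (weight (b, i) < weight (a, j))%N -> F b i = F' b i.

Lemma local_degree (b : 'I_P) i : (i - gen b < j - gen a)%N -> F b i = F' b i.
Proof.
move=> lt_deg; apply: FF'; rewrite /weight /=.
apply: (@leq_trans ((i - gen b).+1 * p)); last first.
  by rewrite (leq_trans _ (leq_addr _ _)) // leq_mul2r lt_deg orbT.
by rewrite mulSn addnC ltn_add2r ltn_mod.
Qed.

Lemma local_translate s i : D 0%N s -> (s <= i)%N -> (i - s < j - gen a)%N ->
  translate F s i = translate F' s i.
Proof.
move=> Ds si lt_deg; have le_s := gen_le (D_mono (leq0n l) (leqnn l) Ds).
rewrite !translateE; case: ltnP => // _; apply: local_degree.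
by rewrite gen_residue; lia.
Qed.

(** The series starts at [gen a + Q], so below [j + Q] only coefficients at distance less than
    [j - gen a] from their leading terms enter. *)
Lemma local_red s : (s < j + Q)%N ->
  red (D 0%N) (translate F) (shift Q (F a)) s =
  red (D 0%N) (translate F') (shift Q (F' a)) s.
Proof.
have [_ Fv _] := Ff a; have [_ Fv' _] := Ff' a.
elim/ltn_ind: s => s IH sj; rewrite !redE; congr (_ - _).
  by rewrite /shift; case: ltnP => // Qs; apply: local_degree; lia.
apply: eq_bigr => -[u us] /= /set_mem Du; rewrite IH //; last exact: ltn_trans sj.
have [lt_u|le_u] := ltnP u (gen a + Q).
  by rewrite (val_ge_red _ _ (val_ge_shift Fv')) ?mul0r.
by rewrite local_translate //; lia.
Qed.

Lemma local_rhs : solve_rhs F a j = solve_rhs F' a j.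
Proof.
have [F1 Fv _] := Ff a; have [_ Fv' _] := Ff' a.
apply: eq_bigr => -[s sj] /= /set_mem Ds; rewrite local_red //.
have [lt_s|gt_s|sE] := ltngtP s (gen a + Q).
- by rewrite (val_ge_red _ _ (val_ge_shift Fv')) ?mul0r.
- by rewrite local_translate //; lia.
(* For [s = gen a + Q] the distance does not drop; [descent] does. *)
congr (_ * _); rewrite !translateE; case: ltnP => // le_j; apply: FF'.
have Ds' := D_mono (leq0n l) (leqnn l) Ds; have [m mE] := gen_dvd Ds'.
have le_s := gen_le Ds'; rewrite /weight /= gen_residue.
have -> : (j + Q - (s - gen s) - gen s = j - gen a)%N by lia.
rewrite ltn_add2l; apply: (@descent_lt _ _ m) => //.
by rewrite {1}mE addKn subnK //; move: le_j; rewrite {1}mE addKn.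
Qed.

End SolveLocal.

Lemma solve_step_local x c c' t :
  (forall t', (weight t' < weight t)%N -> c t' = c' t') ->
  solve_step x c t = solve_step x c' t.
Proof.
case: t => a j cc; rewrite /solve_step /= /normalize.
case: ltngtP => // gj; case: ifPn => //; rewrite notin_setE => nDj.
case: ifP => // _; apply: local_rhs => //; try exact: frame_normalize.
by move=> b i lt_w; rewrite /normalize cc.
Qed.

Lemma solveE x a j :
  solve x a j = normalize (fun a j => if (j + Q)%N \in D 0%N then x a j else
    solve_rhs (solve x) a j) a j.
Proof.
have nE : normalize (solve x) = solve x.
  have e : solve x = normalize (fun a j => if (j + Q)%N \in D 0%N then x a j else
      solve_rhs (normalize (solve x)) a j).
    apply/funext => b; apply/funext => i.
    exact: (wf_fixE _ (@solve_step_local x)).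
  by rewrite e normalize_frame //; exact: frame_normalize.
by rewrite {1}/solve (wf_fixE _ (@solve_step_local x)) /solve_step nE.
Qed.

Lemma solve_frame x : frame (solve x).
Proof.
suff -> : solve x = normalize (fun a j => if (j + Q)%N \in D 0%N then x a j else
    solve_rhs (solve x) a j) by exact: frame_normalize.
by apply/funext => a; apply/funext => j; rewrite solveE.
Qed.

Lemma solve_free x a j : free a j -> solve x a j = x a j.
Proof.
case/and3P => gj /negPf nDj DjQ; rewrite solveE /normalize DjQ nDj.
by rewrite ltnNge (ltnW gj) gtn_eqF.
Qed.

(** At a gap [u] above [gen a + Q], the recursion at [u - Q] is exactly the vanishing of the reduced
    coefficient; [u = gen a + Q] is no gap by [D0_genQ]. *)
Lemma solve_flag_frame x : flag_frame (solve x).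
Proof.
have sf := solve_frame x; split=> // a u nDu; have [_ Fv _] := sf a.
have [lt_u|gt_u|uE] := ltngtP u (gen a + Q).
- by rewrite (val_ge_red _ _ (val_ge_shift Fv)).
- have Qu : (Q <= u)%N by lia.
  have nDuQ : ~ D 0%N (u - Q)%N by move=> /(D_addQ (leq0n l)); rewrite subnK.
  rewrite redE /shift ltnNge Qu /= solveE /normalize subnK //.
  rewrite !memNset // ltnNge gtn_eqF ?ltn_subRL 1?addnC // ltnW ?ltn_subRL 1?addnC //=.
  by rewrite /solve_rhs subnK // subrr.
- by case: nDu; rewrite uE; exact: D0_genQ.
Qed.

Lemma solve_uniq x F : flag_frame F -> (forall a j, free a j -> F a j = x a j) ->
  F = solve x.
Proof.
move=> [Ff FQ] Fx; suff FE t : F t.1 t.2 = solve_step x (fun t => F t.1 t.2) t.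
  apply/funext => a; apply/funext => j.
  exact: (wf_fix_uniq (@solve_step_local x) FE (wf_fixE _ (@solve_step_local x)) (a, j)).
case: t => a j; rewrite /solve_step /= (normalize_frame Ff) /normalize.
have [F1 Fv F0] := Ff a.
case: ltngtP => [jg|gj|-> //]; first by rewrite Fv.
case: ifPn => [/set_mem Dj|nDj]; first by rewrite F0.
case: ifPn => DjQ; first by rewrite Fx // /free gj nDj.
move: DjQ; rewrite notin_setE => /(FQ a)/eqP.
by rewrite redE shift_addn subr_eq0 => /eqP.
Qed.

End OneRing.

(** * Base change of frames *)

Section BaseChange.
Variables (A B : nzRingType) (phi : {rmorphism A -> B}).
Implicit Types (F : 'I_P -> series A).

Lemma translate_map F : translate (fun a => phi \o F a) = fun s => phi \o translate F s.
Proof.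
apply/funext => s; apply/funext => j; rewrite /translate /shift /=.
by case: ifP; rewrite ?rmorph0.
Qed.

Lemma span_map S F f : span S (translate F) f ->
  span S (translate (fun a => phi \o F a)) (phi \o f).
Proof.
by move=> fS j jS; rewrite translate_map rmorph_red /= fS ?rmorph0.
Qed.

Lemma frame_map F : frame F -> frame (fun a => phi \o F a).
Proof.
move=> Ff a; have [F1 Fv F0] := Ff a; split=> [|j jg|j gj Dj] /=; first by rewrite F1 rmorph1.
  by rewrite Fv ?rmorph0.
by rewrite F0 ?rmorph0.
Qed.

Lemma flag_frame_map F : flag_frame F -> flag_frame (fun a => phi \o F a).
Proof.
move=> [Ff FQ]; split=> [|a]; first exact: frame_map.
have := span_map (FQ a); congr (span _ _ _); apply/funext => j; rewrite /shift /=.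
by case: ifP; rewrite ?rmorph0.
Qed.

(** Both sides are flag frames with the same free coefficients. *)
Lemma solve_map x : (fun a => phi \o solve x a) = solve (fun a j => phi (x a j)).
Proof.
apply: solve_uniq; first exact/flag_frame_map/solve_flag_frame.
by move=> a j aj /=; rewrite solve_free.
Qed.

End BaseChange.

(** * The isomorphism with affine space *)

Section Coordinates.

Definition free_index := {t : 'I_P * 'I_n | free t.1 t.2}.

Variable A : nzRingType.

Definition coordinates (v : 'rV[A]_#|{: free_index}|) (a : 'I_P) (j : nat) : A :=
  if insub j is Some j' then
    if insub (a, j') is Some t then v 0 (enum_rank (t : free_index)) else 0
  else 0.

Lemma coordinatesE v (t : free_index) :
  coordinates v (val t).1 (val (val t).2) = v 0 (enum_rank t).
Proof. by rewrite /coordinates valK -surjective_pairing valK. Qed.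

Lemma free_indexP a j : free a j ->
  exists t : free_index, (val t).1 = a /\ val (val t).2 = j.
Proof.
move=> aj; have jn : (j < n)%N.
  rewrite ltnNge; apply/negP => /D0_large Dj; case/and3P: aj => _.
  by rewrite notin_setE.
by exists (exist (fun t : 'I_P * 'I_n => free t.1 t.2) (a, Ordinal jn) aj).
Qed.

End Coordinates.

Section Isomorphism.
Variable k : fieldType.
Hypothesis nE : n = codim k p q r.

Lemma flag_frame_Jpoint (A : comAlgType k) (F : 'I_P -> series A) i :
  (i <= l)%N -> flag_frame F -> @Jpoint k p q r (D i) A (span (D i) (translate F)).
Proof.
move=> il FF; have Dn := D_large il; have [_ Dr] := D_std il.
have tri := translate_triangular il FF.1.
have Mn := val_ge_span (translate F) Dn.
rewrite /Jpoint -/(codim k p q r) -nE; split=> //.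
- exact: flag_frame_submodule.
- exact (jumps_standard p_gt0 q_gt0 r_gt0 Dr Mn (jumps_span tri)).
- exact: (grassmannian_span Dn).
- exact: jumps_span.
Qed.

Lemma Jbc_span (A B : comAlgType k) (phi : {lrmorphism A -> B}) (F : 'I_P -> series A) i :
  (i <= l)%N -> frame F ->
  @Jbc k p q r A B phi (span (D i) (translate F)) =
  span (D i) (translate (fun a => phi \o F a)).
Proof.
move=> il Ff; have Dn := D_large il; have tri := translate_triangular il Ff.
set F' := fun a => phi \o F a.
have [L0 LD LZ] := linear_span (D i) (translate F').
rewrite /Jbc -/(codim k p q r) -nE; apply/seteqP; split=> f /=.
  case=> m [b [g [gM fE]]].
  apply: (linear_set_cut (linear_span _ _) (val_ge_span _ Dn)
    (f := fun j => \sum_(u < m) b u * phi (g u j))).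
  - by move=> j jn; rewrite fE.
  - apply: (linear_set_sum _ (linear_span _ _)) => u _; apply: (LZ _ (phi \o g u)).
    exact: (span_map phi (gM u)).
move=> fM; have Ff' : frame F' by exact: frame_map.
(* The expansion of [f] in the base-changed translates, cut at [n], provides the finite
   [B]-combination. *)
exists n, (fun s => if (s : nat) \in D i then red (D i) (translate F') f s else 0).
exists (fun s => if (s : nat) \in D i then translate F s else fun=> 0); split.
  move=> s; case: ifPn => [/set_mem Ds|_]; first exact: span_h.
  by case: (linear_span (D i) (translate F)).
move=> j jn; rewrite (span_expand (translate_triangular il Ff') fM jn) big_mkcond /=.
apply: eq_bigr => s _; case: ifP => _; last by rewrite mul0r.
by rewrite translate_map.
Qed.

(** Injectivity combines [flag_frame_inj] with [solve_free], surjectivity [flag_frame_exists] with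
    [solve_uniq], and naturality [Jbc_span] with [solve_map]. *)
Lemma Jflag_affine :
  isomorphic (affine_space k #|{: free_index}|) (Jflag k p q r l D).
Proof.
exists (fun (A : comAlgType k) (v : 'rV[A]_#|{: free_index}|) (i : 'I_l.+1) =>
  span (D i) (translate (solve (coordinates v)))).
split=> [A|A B phi v _ /=].
  have sF v := solve_flag_frame (@coordinates A v).
  have il (i : 'I_l.+1) : (i <= l)%N by rewrite -ltnS.
  split=> [v _|v v' _ _ vv'|M [MJ M_mono]] /=.
  - split=> [i|i j ij]; first exact: flag_frame_Jpoint.
    by apply: span_mono; apply: D_mono.
  - have FF' : solve (coordinates v) = solve (coordinates v').
      apply: (flag_frame_inj (sF v) (sF v')) => i; rewrite -ltnS => iil.
      exact: (congr1 (fun M : 'I_l.+1 -> set (series A) => M (Ordinal iil)) vv').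
    apply/rowP => i; rewrite -[i]enum_valK; set t := enum_val i.
    rewrite -!coordinatesE; have tF : free (val t).1 (val (val t).2) := valP t.
    by rewrite -(solve_free (coordinates v) tF) -(solve_free (coordinates v') tF) FF'.
  pose M' i := M (inord i).
  have [|i j ij jl|F FF ME] := @flag_frame_exists A M'.
  - move=> i iil; have [] := MJ (inord i); rewrite -/(codim k p q r) -nE.
    by rewrite inordK // => ? _ ? _ ?.
  - apply: M_mono; rewrite !inordK // ltnS //; exact: leq_trans jl.
  exists (\row_i F (val (enum_val i)).1 (val (val (enum_val i)).2)) => //.
  apply/funext => i; have -> : M i = M' i by rewrite /M' inord_val.
  rewrite ME //; congr (span _ (translate _)); apply/esym/solve_uniq => // a j aj.
  have [t [<- <-]] := free_indexP aj.
  by rewrite coordinatesE mxE enum_rankK.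
apply/funext => i; rewrite Jbc_span; first last.
- by have [] := solve_flag_frame (coordinates v).
- by rewrite -ltnS.
rewrite solve_map; congr (span _ (translate (solve _))).
apply/funext => a; apply/funext => j; rewrite /coordinates.
case: insubP => [j' _ _|_]; last by rewrite rmorph0.
by case: insubP => [t _ _|_]; rewrite ?rmorph0 // mxE.
Qed.

End Isomorphism.

End Frames.

(** * Functoriality of base change on modules *)

Lemma linear_Jbc (k : fieldType) (p q r : nat) (A B : comAlgType k)
    (phi : {lrmorphism A -> B}) M : linear_set (@Jbc k p q r A B phi M).
Proof.
split=> [|f g [n [b [m [mM fE]]]] [n' [b' [m' [mM' gE]]]]|a f [n [b [m [mM fE]]]]].
- by exists 0%N, (fun=> 0), (fun=> fun=> 0); split=> [[]|j _] //; rewrite big_ord0.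
- exists (n + n')%N,
    (fun i : 'I_(n + n') => match fintype.split i with inl u => b u | inr u => b' u end).
  exists
    (fun i : 'I_(n + n') => match fintype.split i with inl u => m u | inr u => m' u end);
    split.
    by move=> i; case: (fintype.split i).
  move=> j jn; rewrite fE // gE // big_split_ord; congr (_ + _); apply: eq_bigr => u _.
    by rewrite (unsplitK (inl u)).
  by rewrite (unsplitK (inr u)).
- exists n, (fun i => a * b i), m; split=> // j jn.
  by rewrite fE // mulr_sumr; apply: eq_bigr => i _; rewrite mulrA.
Qed.

Lemma val_ge_Jbc (k : fieldType) (p q r : nat) (A B : comAlgType k)
    (phi : {lrmorphism A -> B}) M :
  val_ge B (codim k p q r) `<=` @Jbc k p q r A B phi M.
Proof.
move=> f fv; exists 0%N, (fun=> 0), (fun=> fun=> 0); split=> [[]|j jn] //.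
by rewrite big_ord0 fv.
Qed.

Lemma Jbc_comp (k : fieldType) (p q r : nat) (A B C : comAlgType k)
    (phi : {lrmorphism A -> B}) (psi : {lrmorphism B -> C})
    (chi : {lrmorphism A -> C}) M : (forall a, chi a = psi (phi a)) ->
  @Jbc k p q r B C psi (@Jbc k p q r A B phi M) = @Jbc k p q r A C chi M.
Proof.
move=> chiE; apply/seteqP; split=> f /= [n [b [m [mM fE]]]]; last first.
  exists n, b, (fun i => phi \o m i); split=> [i|j jn]; last first.
    by rewrite fE //; apply: eq_bigr => i _; rewrite chiE.
  exists 1%N, (fun=> 1), (fun=> m i); split=> // j _.
  by rewrite big_ord1 mul1r.
apply: (linear_set_cut (linear_Jbc p q r chi M) (@val_ge_Jbc _ _ _ _ _ _ _ _)).
  by move=> j jn; rewrite (fE j jn).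
have lin := linear_Jbc p q r chi M; have [_ _ LZ] := lin.
apply: linear_set_sum => // i _; apply: (LZ _ (fun j => psi (m i j))).
have [d [c [g [gM mE]]]] := mM i.
exists d, (psi \o c), g; split=> // j jn; rewrite mE // rmorph_sum.
by apply: eq_bigr => u _; rewrite rmorphM chiE.
Qed.

Lemma bc_Jflag_comp (k : fieldType) (p q r l : nat) D (A B C : comAlgType k)
    (phi : {lrmorphism A -> B}) (psi : {lrmorphism B -> C})
    (chi : {lrmorphism A -> C}) x : (forall a, chi a = psi (phi a)) ->
  bc (Jflag k p q r l D) psi (bc (Jflag k p q r l D) phi x) =
  bc (Jflag k p q r l D) chi x.
Proof. by move=> chiE; apply/funext => i; exact: Jbc_comp. Qed.

Lemma isomorphic_Jflag0 (k : fieldType) (p q r : nat) D X :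
  isomorphic X (Jflag k p q r 0 D) -> isomorphic X (Jmod k p q r (D 0%N)).
Proof.
move=> [f [fbij fbc]]; exists (fun A x => f A x ord0); split=> [A|A B phi x Xx].
  have [fP finj fsurj] := fbij A; split=> [x /fP[/(_ ord0)]|x y Xx Xy fxy|M JM] //.
    by apply: finj => //; apply/funext => i; rewrite (ord1 i).
  have [|x Xx fx] := fsurj (fun=> M); last by exists x => //; rewrite fx.
  by split=> [i|i j _ //]; rewrite (ord1 i).
by rewrite fbc.
Qed.

(** * Dimension count *)

Lemma standard_flag_mono p q r l D g : standard_flag p q r l D g ->
  forall i j, (i <= j)%N -> (j <= l)%N -> D i `<=` D j.
Proof.
case=> _ Dg _ i j; elim: j => [|j IH]; first by rewrite leqn0 => /eqP-> _.
rewrite leq_eqVlt => /predU1P[-> _ v //|ij jl]; have [_ ->] := Dg j jl.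
by move=> v /(IH ij (ltnW jl)) ?; left.
Qed.

(** Take [i' = 0] for [v] in [D 0], and [i' = j] for [v = g j]: the elements added up to stage [j]
    do not exceed [g j]. *)
Lemma standard_flag_incr p q r l D g : standard_flag p q r l D g ->
  forall i v, (i <= l)%N -> D i v -> exists2 i', (i' <= i)%N &
    D i' v /\ forall u, (v < u)%N -> D i' u -> D 0%N u.
Proof.
move=> flagD; have [_ Dg g_incr] := flagD.
have DE i v : (i <= l)%N -> D i v ->
    D 0%N v \/ exists2 j, (0 < j <= i)%N & v = g j.
  elim: i => [|i IH] il; first by left.
  have [_ ->] := Dg i il; case=> [/(IH (ltnW il))[|[j /andP[j0 ji] ->]]|->].
  - by left.
  - by right; exists j; rewrite // j0 ltnW.
  - by right; exists i.+1; rewrite //= leqnn.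
move=> i v il /(DE _ _ il)[D0v|[j /andP[j0 ji] ->]]; first by exists 0%N.
have jl := leq_trans ji il; exists j => //; split.
  by case: j j0 jl {ji} => // j _ jl; have [_ ->] := Dg j jl; right.
move=> u gu /(DE _ _ jl)[//|[j' /andP[j'0 j'j] uE]].
move: gu; rewrite uE ltnNge; case/negP; case: (ltngtP j' j) j'j => // [j'j|->] //.
by rewrite ltnW // g_incr.
Qed.

Lemma gamma_eq (D D' : set nat) b : (forall u, (b <= u)%N -> D u <-> D' u) ->
  gamma D b = gamma D' b.
Proof.
move=> DD'; rewrite /gamma; congr (#|` fset_set _|%fset).
by apply/seteqP; split=> u [/= bu nDu]; split=> //; move/DD': nDu; apply.
Qed.

Lemma gammaS (D : set nat) b : D b -> gamma D b = gamma D b.+1.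
Proof.
move=> Db; rewrite /gamma; congr (#|` fset_set _|%fset).
apply/seteqP; split=> u [/= bu nDu]; split=> //=; last exact: ltnW.
by rewrite ltn_neqAle bu andbT; apply/eqP => bE; apply: nDu; rewrite -bE.
Qed.

Section Count.
Variables (p q r n : nat) (D0 : set nat).
Hypotheses (p_gt0 : (0 < p)%N) (q_gt0 : (0 < q)%N) (r_gt0 : (0 < r)%N).
Hypothesis D0_std : standard_Gamma_module p q r D0.
Hypothesis D0_large : forall j, (n <= j)%N -> D0 j.
Local Notation P := (r * p)%N.
Local Notation Q := (r * q)%N.

Definition generator_count (v : nat) : nat :=
  \sum_(j < n | [&& (v < j)%N, (j : nat) \notin D0 & (j + Q)%N \in D0]) 1.

(** [D0] stands for the smallest module of a flag and [E] for the largest; this counts the free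
    coordinates. *)
Definition flag_dim (E : set nat) : nat := \sum_(a < P) generator_count (gen P E a).

Lemma card_free_index l D : D 0%N = D0 -> #|{: free_index p q r l n D}| = flag_dim (D l).
Proof.
move=> D0E; rewrite card_sig -sum1_card /flag_dim.
rewrite -(pair_big_dep xpredT (fun (a : 'I_P) (j : 'I_n) => free q l D a j) (fun _ _ => 1%N)) /=.
by apply: eq_bigr => a _; apply: eq_bigl => j; rewrite /free D0E.
Qed.

Lemma Gamma_moduleP (E : set nat) s : Gamma_module p q r E -> E s -> E (s + P)%N.
Proof.
move=> EG Es; apply: EG => //.
by exists 1%N, 0%N; rewrite mul1n mul0n addn0.
Qed.

Lemma Gamma_moduleQ (E : set nat) s : Gamma_module p q r E -> E s -> E (s + Q)%N.
Proof.
move=> EG Es; apply: EG => //.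
by exists 0%N, 1%N; rewrite mul1n mul0n add0n.
Qed.

(** Gaps [j > v] for which [j + Q] is also a gap correspond to the gaps from [v + Q] on; the
    hypothesis excludes [j = v]. *)
Lemma generator_countE v : D0 (v + Q)%N ->
  (generator_count v + gamma D0 (v + Q) = gamma D0 v.+1)%N.
Proof.
move=> DvQ; have [D0G _] := D0_std.
(* The bound [n + Q] in the second count matches [j < n] after translation by [Q]. *)
rewrite (@gammaE _ _ v.+1 D0_large) (@gammaE (n + Q)); last first.
  by move=> j nj; apply: D0_large; apply: leq_trans nj; exact: leq_addr.
rewrite [RHS](bigID (fun j : 'I_n => (j + Q)%N \in D0)) /=; congr (_ + _)%N.
  by apply: eq_bigl => j; rewrite andbA.
rewrite -(big_mkord (fun j => (v + Q <= j)%N && (j \notin D0)) (fun=> 1%N)).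
rewrite (big_cat_nat (n := Q)) ?leq_addl //= big1_seq ?add0n; last first.
  move=> j /andP[/andP[vQj _]]; rewrite mem_index_iota => /andP[_ jQ].
  by move: vQj; rewrite leqNgt (leq_trans jQ) ?leq_addl.
rewrite -{1}[Q]add0n big_addn addnK big_mkord; apply: eq_bigl => j.
rewrite leq_add2r; have [jDQ|jDQ] := boolP ((j + Q)%N \in D0); first by rewrite !andbF.
rewrite !andbT; have nDj : ~ D0 j.
  by move=> /(Gamma_moduleQ D0G)/mem_set; rewrite (negPf jDQ).
rewrite memNset //= andbT leq_eqVlt; case: eqP => //= vj.
by move: jDQ; rewrite -vj mem_set.
Qed.

Lemma flag_dim_add (E : set nat) g :
  D0 `<=` E -> Gamma_module p q r E -> ~ E g -> Gamma_module p q r (E `|` [set g]) ->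
  (flag_dim (E `|` [set g]) + generator_count (g + P) =
   flag_dim E + generator_count g)%N.
Proof.
move=> DE EG nEg E'G; have P_gt0 : (0 < P)%N by rewrite muln_gt0 r_gt0.
have E_large j : (n <= j)%N -> E j by move=> /D0_large/DE.
have E'_large j : (n <= j)%N -> (E `|` [set g]) j by move=> /E_large; left.
have EgP : E (g + P)%N.
  have [//|/eqP] := Gamma_moduleP E'G (or_intror erefl : (E `|` [set g]) g).
  by rewrite -{2}[g]addn0 eqn_add2l gtn_eqF.
have EP e m : E e -> E (e + m * P)%N.
  move=> Ee; elim: m => [|m IH]; first by rewrite addn0.
  by rewrite mulSnr addnA; apply: Gamma_moduleP.
have not_le e : E e -> e = g %[mod P] -> (g < e)%N.
  move=> Ee eg; rewrite ltnNge; apply/negP => le_eg; apply: nEg.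
  have /dvdnP[m mE] : (P %| g - e)%N by rewrite -eqn_mod_dvd // eg.
  by rewrite -(subnKC le_eg) mE; apply: EP.
have gE' : gen P (E `|` [set g]) g = g.
  apply: (gen_uniq P_gt0 E'_large) => //; first by right.
  by move=> e [/not_le lt_ge /lt_ge/ltnW|->].
have gE : gen P E g = (g + P)%N.
  apply: (gen_uniq P_gt0 E_large) => //; first by rewrite modnDr.
  move=> e Ee eg; have lt_ge := not_le e Ee eg.
  have /dvdnP[[|m] mE] : (P %| e - g)%N by rewrite -eqn_mod_dvd ?eg // ltnW.
    by move: mE; lia.
  by rewrite -(subnKC (ltnW lt_ge)) mE leq_add2l mulSn leq_addr.
have gen_ne a : a != g %[mod P] -> gen P (E `|` [set g]) a = gen P E a.
  move=> ag; have [Ee ea emin] := genP P_gt0 E_large a.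
  apply: (gen_uniq P_gt0 E'_large) => //; first by left.
  by move=> e' [|-> ga]; [exact: emin|rewrite ga eqxx in ag].
rewrite /flag_dim; pose a0 := Ordinal (ltn_pmod g P_gt0).
rewrite [in LHS](bigD1 a0) //= [in RHS](bigD1 a0) //=.
rewrite (gen_eqmod P_gt0 E'_large (modn_mod g P)) gE'.
rewrite (gen_eqmod P_gt0 E_large (modn_mod g P)) gE.
rewrite (eq_bigr (fun a : 'I_P => generator_count (gen P E a))) => [|a aa0]; first by lia.
rewrite gen_ne //; apply: contraNneq aa0 => ag; apply/eqP/val_inj => /=.
by rewrite -ag modn_small.
Qed.

(** The change is [generator_count g - generator_count (g + P)]. Above [g], [E'] and [D0] agree, and
    as [g] is in [E'] and [g + P] in [D0], the successors from [generator_countE] disappear. *)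
Lemma flag_dim_step (E : set nat) g (E' := E `|` [set g]) :
  D0 `<=` E -> Gamma_module p q r E -> ~ E g -> Gamma_module p q r E' ->
  (forall u, (g < u)%N -> E u -> D0 u) ->
  (flag_dim E')%:Z - (flag_dim E)%:Z =
    (gamma E' g)%:Z - (gamma E' (g + P))%:Z
    - ((gamma E' (g + Q))%:Z - (gamma E' (g + P + Q))%:Z).
Proof.
move=> DE EG nEg E'G tail.
have P_gt0 : (0 < P)%N by rewrite muln_gt0 r_gt0.
have Q_gt0 : (0 < Q)%N by rewrite muln_gt0 r_gt0.
have E'D u : (g < u)%N -> E' u <-> D0 u.
  move=> gu; split=> [[/(tail _ gu) //|ug]|/DE]; last by left.
  by move: gu; rewrite ug ltnn.
have E'g : E' g by right.
have D0gP : D0 (g + P)%N by apply/E'D; [lia|exact: Gamma_moduleP].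
have D0gQ : D0 (g + Q)%N by apply/E'D; [lia|exact: Gamma_moduleQ].
have [D0G _] := D0_std; have D0gPQ := Gamma_moduleQ D0G D0gP.
have gammaD b : (g < b)%N -> gamma E' b = gamma D0 b.
  by move=> gb; apply: gamma_eq => u bu; apply: E'D; apply: leq_trans bu.
rewrite (gammaS E'g) !gammaD; [|lia..].
have := flag_dim_add DE EG nEg E'G.
have := generator_countE D0gQ; have := generator_countE D0gPQ.
by rewrite -/E' -(gammaS D0gP); lia.
Qed.

End Count.

Lemma isomorphic_Jflag (k : fieldType) (p q r l : nat) D g
    (n := codim k p q r) :
  (0 < p)%N -> (0 < q)%N -> coprime p q -> (0 < r)%N ->
  standard_flag p q r l D g ->
  isomorphic (affine_space k (flag_dim p q r n (D 0%N) (D l))) (Jflag k p q r l D).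
Proof.
move=> p_gt0 q_gt0 pq r_gt0 flagD; have [D_std _ _] := flagD.
rewrite -(@card_free_index p q r n (D 0%N) l D erefl).
apply: Jflag_affine => //.
- exact: standard_flag_mono flagD.
- exact: standard_flag_incr flagD.
- exact: standard_large (D_std 0%N _).
Qed.

(** * Dimensions of the varieties and the formula for [mu] *)

Section Dimensions.
Variables (k : fieldType) (p q r : nat).
Hypotheses (p_gt0 : (0 < p)%N) (q_gt0 : (0 < q)%N) (pq_coprime : coprime p q).
Hypothesis r_gt0 : (0 < r)%N.
Local Notation n := (codim k p q r).

Lemma var_dim_Jflag l D g : standard_flag p q r l D g ->
  var_dim (Jflag k p q r l D) = flag_dim p q r n (D 0%N) (D l).
Proof.
move=> flagD; apply: var_dim_affine; last exact: isomorphic_Jflag flagD.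
by move=> A B C phi psi chi x; apply: bc_Jflag_comp.
Qed.

Lemma var_dim_Jmod D : standard_Gamma_module p q r D ->
  var_dim (Jmod k p q r D) = flag_dim p q r n D D.
Proof.
move=> stdD; apply: var_dim_affine.
  by move=> A B C phi psi chi x; apply: Jbc_comp.
apply: (@isomorphic_Jflag0 _ _ _ _ (fun=> D)).
by apply: (@isomorphic_Jflag _ _ _ _ 0 (fun=> D) id) => //; split=> // i j; lia.
Qed.

Lemma mu_flag_dim D g : standard_Gamma_module p q r D -> ~ D g ->
  Gamma_module p q r (D `|` [set g]) ->
  mu k p q r D g =
    (flag_dim p q r n D (D `|` [set g]))%:Z - (flag_dim p q r n D D)%:Z.
Proof.
move=> stdD nDg D'G; rewrite /mu var_dim_Jmod //.
(* In length one the order condition is vacuous, so a constant sequence serves. *)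
rewrite (@var_dim_Jflag 1 _ (fun=> g)) //; split=> [i|i|i j]; last by lia.
  case: i => [|i] //= _; split=> // i' i'r; left; exact: stdD.2.
by case: i.
Qed.

Lemma mu_gamma D g (D' := D `|` [set g]) : standard_Gamma_module p q r D ->
  ~ D g -> Gamma_module p q r D' ->
  mu k p q r D g = (gamma D' g)%:Z - (gamma D' (g + r * p))%:Z
    - ((gamma D' (g + r * q))%:Z - (gamma D' (g + r * p + r * q))%:Z).
Proof.
move=> stdD nDg D'G; rewrite mu_flag_dim // flag_dim_step //.
- exact: standard_large.
- exact: stdD.1.
Qed.

(* Above [g i.+1], the modules [D i] and [D 0] coincide, so that the variation of
   [flag_dim (D 0)] between [D i] and [D i.+1] is the one of [flag_dim (D i)]. *)
Lemma flag_dim_sum_mu l D g : standard_flag p q r l D g ->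
  (flag_dim p q r n (D 0%N) (D l))%:Z =
  (flag_dim p q r n (D 0%N) (D 0%N))%:Z + \sum_(0 <= i < l) mu k p q r (D i) (g i.+1).
Proof.
move=> flagD; have [D_std Dg g_incr] := flagD.
have D_mono := standard_flag_mono flagD.
have D_incr := standard_flag_incr flagD.
suff main m : (m <= l)%N -> (flag_dim p q r n (D 0%N) (D m))%:Z =
    (flag_dim p q r n (D 0%N) (D 0%N))%:Z + \sum_(0 <= i < m) mu k p q r (D i) (g i.+1).
  exact: main.
elim: m => [_|m IH ml]; first by rewrite big_geq // addr0.
have [nDg DS] := Dg m ml; have stdD := D_std m (ltnW ml).
have D'G : Gamma_module p q r (D m `|` [set g m.+1]).
  by rewrite -DS; have [] := D_std m.+1 ml.
rewrite big_nat_recr //= addrA -IH ?(ltnW ml) // mu_gamma // DS.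
apply/eqP; rewrite addrC -subr_eq; apply/eqP.
apply: flag_dim_step => //.
- exact: D_std.
- exact: standard_large (D_std 0%N _).
- exact: D_mono (ltnW ml).
- exact: stdD.1.
(* The index from [D_incr] can only be [m.+1], since [g m.+1] is not in [D m]. *)
move=> u gu Du; have Dg' : D m.+1 (g m.+1) by rewrite DS; right.
have [i' i'm [Di' tail]] := D_incr m.+1 _ ml Dg'.
apply: tail => //; have [i'E|lt_i'] : i' = m.+1 \/ (i' <= m)%N by lia.
  by rewrite i'E DS; left.
by case: nDg; apply: D_mono Di'; rewrite // ltnW.
Qed.

End Dimensions.

Theorem theorem3p2 (k : fieldType) (p q r : nat)
    (hp : (0 < p)%N) (hpq : (p < q)%N) (hcop : coprime p q) (hr : (0 < r)%N) :
  (forall (l : nat) (D : nat -> set nat) (g : nat -> nat),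
     standard_flag p q r l D g ->
     exists N : nat,
       isomorphic (affine_space k N) (Jflag k p q r l D) /\
       N%:Z = (var_dim (Jmod k p q r (D 0%N)))%:Z
              + \sum_(0 <= i < l) mu k p q r (D i) (g i.+1)) /\
  (forall (D : set nat) (g : nat),
     standard_Gamma_module p q r D -> ~ D g ->
     Gamma_module p q r (D `|` [set g]) ->
     let D' := D `|` [set g] in
     mu k p q r D g =
       (gamma D' g)%:Z - (gamma D' (g + r * p))%:Z
       - ((gamma D' (g + r * q))%:Z - (gamma D' (g + r * p + r * q))%:Z)).
Proof.
have hq : (0 < q)%N := ltn_trans hp hpq.
split=> [l D g flagD|D g stdD nDg D'G D']; last exact: mu_gamma.
have [D_std _ _] := flagD.
exists (flag_dim p q r (codim k p q r) (D 0%N) (D l)); split.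
  exact: isomorphic_Jflag flagD.
by rewrite var_dim_Jmod //; [exact: flag_dim_sum_mu | exact: D_std].
Qed.
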